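(* Let $A$ be a coherent ring which is $\aleph_n$-Noetherian for some integer $n\ge -1$. For a set $\Sigma$ of ideals of $A$, say $A$ has finite global dimension on $\Sigma$ if $\sup\{\mathrm{pd}_A(A/\mathfrak{a}):\mathfrak{a}\in\Sigma\}<\infty$. Then the following are equivalent: (i) $\mathrm{gldim}\,A<\infty$; (ii) $A$ has finite global dimension on the set of radical ideals; (iii) $A$ has finite global dimension on the set of prime ideals; (iv) $A$ has finite global dimension on the set of maximal ideals; (v) $A$ has finite global dimension on the set of finitely generated ideals.
   Context: A ring is coherent if every finitely generated ideal is finitely presented. $\aleph_{-1}$ denotes the cardinality of finite sets, $\aleph_0$ that of $\mathbb{N}$, $\aleph_1,\aleph_2,\ldots$ the successive uncountable cardinals; a ring is $\aleph_n$-Noetherian if each of its ideals can be generated by a set of cardinality at most $\aleph_n$. *)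

(* Defs.v *)
From HB Require Import structures.
From mathcomp Require Import all_boot all_order all_algebra.
From Stdlib Require Import List.
Set Implicit Arguments. Unset Strict Implicit. Unset Printing Implicit Defensive.
Import GRing.Theory.
Local Open Scope ring_scope.

Section Defs.
Variable A : comPzRingType.

Definition is_ideal (I : A -> Prop) : Prop :=
  [/\ I 0, (forall x y, I x -> I y -> I (x + y)) & (forall r x, I x -> I (r * x))].

Definition ideal_gen (S : A -> Prop) (x : A) : Prop :=
  exists (n : nat) (g c : 'I_n -> A),
    (forall i, S (g i)) /\ x = \sum_(i < n) c i * g i.

Definition ideal_gen_by (n : nat) (g : 'I_n -> A) (I : A -> Prop) : Prop :=
  forall x, I x <-> exists c : 'I_n -> A, x = \sum_(i < n) c i * g i.

Definition fg_ideal (I : A -> Prop) : Prop :=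
  exists (n : nat) (g : 'I_n -> A), ideal_gen_by g I.

(* I is finitely presented: a presentation A^m -> A^n -> I -> 0 *)
Definition fp_ideal (I : A -> Prop) : Prop :=
  exists (n : nat) (g : 'I_n -> A), ideal_gen_by g I /\
  exists (m : nat) (r : 'I_m -> 'I_n -> A),
    forall c : 'I_n -> A,
      (\sum_(i < n) c i * g i = 0) <->
      exists d : 'I_m -> A, forall i, c i = \sum_(j < m) d j * r j i.

Definition coherent : Prop :=
  forall I, is_ideal I -> fg_ideal I -> fp_ideal I.

Definition radical_ideal (I : A -> Prop) : Prop :=
  is_ideal I /\ forall x (k : nat), I (x ^+ k) -> I x.

Definition prime_ideal (I : A -> Prop) : Prop :=
  [/\ is_ideal I, ~ I 1 & forall x y, I (x * y) -> I x \/ I y].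

Definition maximal_ideal (I : A -> Prop) : Prop :=
  [/\ is_ideal I, ~ I 1 &
      forall J, is_ideal J -> (forall x, I x -> J x) -> ~ J 1 -> forall x, J x -> I x].

Definition surj (M N : Type) (f : M -> N) : Prop := forall y, exists x, f x = y.

Definition projective (P : lmodType A) : Prop :=
  forall (M N : lmodType A) (f : {linear M -> N}) (g : {linear P -> N}),
    surj f -> exists h : {linear P -> M}, forall x, f (h x) = g x.

(* pd_A(M) <= n : there is a projective resolution
   0 -> P_n -> P_(n-1) -> ... -> P_0 -> M -> 0 *)
Definition pd_le (M : lmodType A) (n : nat) : Prop :=
  exists (P : nat -> lmodType A) (d : forall i, {linear P i.+1 -> P i})
         (e : {linear P 0%N -> M}),
  [/\ forall i, (i <= n)%N -> projective (P i),
      surj e,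
      (forall x : P 0%N, e x = 0 <-> ((0 < n)%N /\ exists y, d 0%N y = x)),
      (forall i, (i.+1 < n)%N -> forall x : P i.+1,
                   d i x = 0 <-> exists y, d i.+1 y = x) &
      (forall m, n = m.+1 -> forall x : P m.+1, d m x = 0 -> x = 0)].

(* pd_A(A/a) <= n, where A/a is (any module isomorphic to) the cyclic module
   A^o / a : a surjective linear image of A with kernel a. *)
Definition pd_quot_le (a : A -> Prop) (n : nat) : Prop :=
  forall (Q : lmodType A) (q : {linear A^o -> Q}),
    surj q -> (forall x : A, q x = 0 <-> a x) -> pd_le Q n.

Definition gldim_finite : Prop :=
  exists n : nat, forall M : lmodType A, pd_le M n.

Definition fin_gldim_on (Sigma : (A -> Prop) -> Prop) : Prop :=
  exists n : nat, forall a, Sigma a -> pd_quot_le a n.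

End Defs.

(* ---- cardinals aleph_(k-1), k : nat ----
   le_aleph 0 X   : X finite                 (|X| <= aleph_{-1})
   le_aleph k.+1 X: X has a well-order all of whose proper initial
                    segments have cardinality <= aleph_{k-1};
                    equivalently |X| <= aleph_k. *)
Fixpoint le_aleph (k : nat) (X : Type) : Prop :=
  match k with
  | 0 => exists s : list X, forall x, List.In x s
  | k'.+1 => exists R : X -> X -> Prop,
      [/\ well_founded R,
          (forall x y z, R x y -> R y z -> R x z),
          (forall x y, R x y \/ x = y \/ R y x) &
          (forall x, le_aleph k' {y : X | R y x})]
  end.

(* aleph_{k-1}-Noetherian: every ideal is generated by a set of
   cardinality at most aleph_{k-1} *)
Definition aleph_noetherian (k : nat) (A : comPzRingType) : Prop :=
  forall I : A -> Prop, is_ideal I ->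
    exists S : A -> Prop, le_aleph k {x : A | S x} /\
      forall x, I x <-> ideal_gen S x.

(* Main.v *)
From HB Require Import structures.
From mathcomp Require Import all_boot all_order all_algebra.
From mathcomp Require Import boolp classical_sets wochoice functions.
From Stdlib Require Import Wellfounded.
Require Import Defs.

(* (i) => (ii) => (iii) => (iv) only uses that maximal ideals are prime and prime
   ideals radical.

   (iv) => (v): coherence gives A/a, for a finitely generated ideal a, a
   resolution by finitely generated free modules, i.e. an exact sequence of
   matrices D_i. If all A/m have projective dimension at most n, then
   Tor_(n+1)(A/a, A/m) = 0, i.e. D_(n+1), D_n stay exact modulo every maximal
   ideal m. By Cayley-Hamilton some s outside m then satisfies s D_n = D_n H D_n
   for some H. These s form an ideal, hence D_n = D_n H D_n for some H, so coker
   D_n, the n-th syzygy of A/a, is projective.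

   (v) => (i): by Auslander's lemma, a module with a well-ordered filtration
   whose successive quotients have projective dimension at most n has itself
   projective dimension at most n. An ideal generated by aleph_k elements is the
   union of a well-ordered chain of ideals with fewer generators, so by induction
   on k all ideals have bounded projective dimension; any module is filtered with
   cyclic successive quotients, which bounds the global dimension. *)

Set Implicit Arguments. Unset Strict Implicit. Unset Printing Implicit Defensive.
Import GRing.Theory.
Local Open Scope ring_scope.

(** * Submodules and quotient modules *)

Section Modules.
Variable A : comPzRingType.
Implicit Types M N P Q K : lmodType A.

Definition linear_map M N (f : M -> N) (hf : linear f) : {linear M -> N} :=
  HB.pack f (GRing.isLinear.Build A M N *:%R f hf).

Definition submod M (S : M -> Prop) : Prop :=
  S 0 /\ forall a x y, S x -> S y -> S (a *: x + y).

Section SubmodTheory.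
Variables (M : lmodType A) (S : M -> Prop) (hS : submod S).

Lemma submodD x y : S x -> S y -> S (x + y).
Proof. by move=> Sx Sy; rewrite -[x]scale1r; apply: hS.2. Qed.

Lemma submodZ a x : S x -> S (a *: x).
Proof. by move=> Sx; rewrite -[_ *: _]addr0; apply: hS.2 => //; apply: hS.1. Qed.

Lemma submodN x : S x -> S (- x).
Proof. by move=> Sx; rewrite -scaleN1r; apply: submodZ. Qed.

Lemma submodB x y : S x -> S y -> S (x - y).
Proof. by move=> Sx Sy; apply: submodD => //; apply: submodN. Qed.

Lemma submod_sum I (r : seq I) (F : I -> M) :
  (forall i, S (F i)) -> S (\sum_(i <- r) F i).
Proof. by move=> SF; elim/big_ind: _ => //; [exact: hS.1|exact: submodD]. Qed.

(** Taking the proof of [submod S] as an argument lets the module structure be inferred from the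
    type; reflecting [S] makes membership boolean, as a subtype requires. *)
Definition subm of submod S := {x : M | `[<S x>]}.
Local Notation W := (subm hS).
HB.instance Definition _ := [isSub of W for @sval M _].
HB.instance Definition _ := [Choice of W by <:].
Fact subm_closed : GRing.subsemimod_closed (fun x : M => `[<S x>]).
Proof.
split; first split; first exact/asboolP/hS.1.
  by move=> x y /asboolP Sx /asboolP Sy; apply/asboolP/submodD.
by move=> a x /asboolP Sx; apply/asboolP/submodZ.
Qed.
HB.instance Definition _ :=
  GRing.SubChoice_isSubLmodule.Build A M (fun x => `[<S x>]) W subm_closed.

Definition submval : {linear subm hS -> M} := val.

Lemma submvalP (x : subm hS) : S (submval x).
Proof. exact/asboolP/(valP x). Qed.

Lemma submval_inj : injective submval.
Proof. exact: val_inj. Qed.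

(** Elements outside [S] go to 0, so linearity holds only on [S]. *)
Definition insubm (x : M) : subm hS := insubd 0 x.

Lemma insubmK x : S x -> submval (insubm x) = x.
Proof. by move=> Sx; rewrite /submval /= val_insubd; case: asboolP. Qed.

Lemma submvalK x : insubm (submval x) = x.
Proof. by apply: submval_inj; rewrite insubmK //; apply: submvalP. Qed.

Lemma insubm_linear a x y :
  S x -> S y -> insubm (a *: x + y) = a *: insubm x + insubm y.
Proof.
move=> Sx Sy; apply: submval_inj.
by rewrite linearP !insubmK //; apply: hS.2.
Qed.

(* The quotient consists of the elements which are the chosen representative of
   their class. *)
Definition qrep (x : M) : M := choose (fun y => `[<S (y - x)>]) x.

Lemma qrepP x : S (qrep x - x).
Proof.
apply/asboolP; apply: (@chooseP M (fun y => `[<S (y - x)>])).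
by apply/asboolP; rewrite subrr; apply: hS.1.
Qed.

Lemma qrep_eq x y : S (x - y) -> qrep x = qrep y.
Proof.
move=> Sxy.
have E : (fun z => `[<S (z - x)>]) =1 (fun z => `[<S (z - y)>]).
  move=> z; apply/asboolP/asboolP => h.
    by rewrite -(subrK x z) -addrA; apply: submodD.
  by rewrite -(subrK y z) -addrA; apply: submodD => //; rewrite -opprB; apply: submodN.
rewrite /qrep (eq_choose E); apply: choose_id; apply/asboolP => //.
by rewrite subrr; apply: hS.1.
Qed.

Lemma qrep_inj x y : qrep x = qrep y -> S (x - y).
Proof.
move=> e; have -> : x - y = (qrep y - y) - (qrep x - x).
  by rewrite e opprB [RHS]addrC addrA subrK.
by apply: submodB; apply: qrepP.
Qed.

Lemma qrepK x : qrep (qrep x) = qrep x.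
Proof. exact/qrep_eq/qrepP. Qed.

Definition quotm of submod S := {x : M | qrep x == x}.
Local Notation V := (quotm hS).
HB.instance Definition _ := [isSub of V for @sval M _].
HB.instance Definition _ := [Choice of V by <:].

Definition qclass (x : M) : V :=
  exist (fun y => qrep y == y) (qrep x) (introT eqP (qrepK x)).

Lemma qclassP x y : qclass x = qclass y <-> S (x - y).
Proof.
split=> [e|h]; first by apply: qrep_inj; have := congr1 val e.
by apply: val_inj; apply: qrep_eq.
Qed.

Lemma qclass_val (x : V) : qclass (val x) = x.
Proof. by apply: val_inj => /=; apply/eqP/(valP x). Qed.

Lemma val_qclass x : S (val (qclass x) - x).
Proof. exact: qrepP. Qed.

Let qadd (x y : V) := qclass (val x + val y).
Let qopp (x : V) := qclass (- val x).
Let qscale a (x : V) := qclass (a *: val x).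

Let qaddE x y : qadd (qclass x) (qclass y) = qclass (x + y).
Proof. by apply/qclassP; rewrite opprD addrACA; apply: submodD; apply: val_qclass. Qed.
Let qoppE x : qopp (qclass x) = qclass (- x).
Proof. by apply/qclassP; rewrite -opprD; apply/submodN/val_qclass. Qed.
Let qscaleE a x : qscale a (qclass x) = qclass (a *: x).
Proof. by apply/qclassP; rewrite -scalerBr; apply/submodZ/val_qclass. Qed.

Let qW (R : V -> Prop) : (forall x, R (qclass x)) -> forall x, R x.
Proof. by move=> h x; rewrite -(qclass_val x). Qed.

Fact qaddA : associative qadd.
Proof. by elim/qW=> x; elim/qW=> y; elim/qW=> z; rewrite !qaddE addrA. Qed.
Fact qaddC : commutative qadd.
Proof. by elim/qW=> x; elim/qW=> y; rewrite !qaddE addrC. Qed.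
Fact qadd0 : left_id (qclass 0) qadd.
Proof. by elim/qW=> x; rewrite !qaddE add0r. Qed.
Fact qaddN : left_inverse (qclass 0) qopp qadd.
Proof. by elim/qW=> x; rewrite qoppE qaddE addNr. Qed.
HB.instance Definition _ := GRing.isZmodule.Build V qaddA qaddC qadd0 qaddN.

Fact qscaleA a b v : qscale a (qscale b v) = qscale (a * b) v.
Proof. by elim/qW: v => v; rewrite !qscaleE scalerA. Qed.
Fact qscale1 : left_id 1 qscale.
Proof. by elim/qW => v; rewrite !qscaleE scale1r. Qed.
Fact qscaleDr : right_distributive qscale qadd.
Proof. by move=> a; elim/qW => x; elim/qW=> y; rewrite qaddE !qscaleE scalerDr qaddE. Qed.
Fact qscaleDl v : {morph qscale^~ v: a b / a + b >-> qadd a b}.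
Proof. by move=> a b; elim/qW: v => x; rewrite !qscaleE qaddE scalerDl. Qed.
HB.instance Definition _ :=
  GRing.Zmodule_isLmodule.Build A V qscaleA qscale1 qscaleDr qscaleDl.

Fact qclass_linear : linear qclass.
Proof. by move=> a x y; rewrite -[LHS]qaddE -qscaleE. Qed.

Definition quotmap : {linear M -> quotm hS} := linear_map qclass_linear.

Lemma quotmap_surj : surj quotmap.
Proof. by move=> x; exists (val x); apply: qclass_val. Qed.

Lemma quotmap_ker x : quotmap x = 0 <-> S x.
Proof. by have := qclassP x 0; rewrite subr0. Qed.

End SubmodTheory.
End Modules.

(** * Projective modules, short exact sequences and projective dimension *)

Section ProjDim.
Variable A : comPzRingType.
Implicit Types M N P Q K C X Y : lmodType A.

(** A choice [s] of preimages under [c] need not be linear, but [f \o s] is: two preimages of a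
    point differ by an element that [f] kills. *)
Lemma factor_surj P C N (c : {linear P -> C}) (f : {linear P -> N}) :
  surj c -> (forall x, c x = 0 -> f x = 0) ->
  exists g : {linear C -> N}, forall x, g (c x) = f x.
Proof.
move=> /choice[s sK] cf.
have E x y : c x = c y -> f x = f y.
  move=> e; apply/eqP; rewrite -subr_eq0 -linearB; apply/eqP/cf.
  by rewrite linearB e subrr.
have gl : linear (f \o s).
  by move=> a x y /=; rewrite -linearP; apply: E; rewrite linearP !sK.
by exists (linear_map gl) => x /=; apply: E; rewrite sK.
Qed.

Lemma factor_inj K X Y (i : {linear K -> X}) (f : {linear Y -> X}) :
  injective i -> (forall y, exists k, i k = f y) ->
  exists g : {linear Y -> K}, forall y, i (g y) = f y.
Proof.
move=> inji /choice[g gE].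
have gl : linear g by move=> a x y; apply: inji; rewrite linearP !gE linearP.
by exists (linear_map gl).
Qed.

Lemma projective_split P M (e : {linear M -> P}) : projective P -> surj e ->
  exists s : {linear P -> M}, forall x, e (s x) = x.
Proof. by move=> pP se; apply: (pP M P e idfun se). Qed.

Lemma projective_retract P C (s : {linear C -> P}) (p : {linear P -> C}) :
  projective P -> (forall x, p (s x) = x) -> projective C.
Proof.
move=> pP psK M N f g sf; have [h hE] := pP M N f (g \o p) sf.
by exists (h \o s) => x /=; rewrite hE /= psK.
Qed.

Lemma projective_prod P Q : projective P -> projective Q ->
  projective (P * Q)%type.
Proof.
move=> pP pQ M N f g sf.
have l1 : linear (fun x : P => g (x, 0)).
  by move=> a x y; rewrite -linearP; congr (g (_, _)); rewrite /= scaler0 addr0.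
have l2 : linear (fun x : Q => g (0, x)).
  by move=> a x y; rewrite -linearP; congr (g (_, _)); rewrite /= scaler0 addr0.
have [h1 h1E] := pP M N f (linear_map l1) sf.
have [h2 h2E] := pQ M N f (linear_map l2) sf.
have hl : linear (fun x : P * Q => h1 x.1 + h2 x.2).
  by move=> a x y; rewrite /= !linearP addrACA scalerDr.
exists (linear_map hl) => -[x y] /=.
rewrite linearD h1E h2E /= -linearD; congr (g (_, _)) => /=.
  by rewrite addr0.
by rewrite add0r.
Qed.

Definition ses K P M (i : {linear K -> P}) (e : {linear P -> M}) : Prop :=
  [/\ injective i, surj e & forall x, e x = 0 <-> exists y, i y = x].

Lemma ses_comp0 K P M (i : {linear K -> P}) (e : {linear P -> M}) :
  ses i e -> forall x, e (i x) = 0.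
Proof. by case=> _ _ ex x; apply/ex; exists x. Qed.

Lemma ker_submod M N (f : {linear M -> N}) : submod (fun x => f x = 0).
Proof.
by split=> [|a x y fx fy]; rewrite ?linear0 // linearP fx fy scaler0 addr0.
Qed.

Lemma ses_ker M N (f : {linear M -> N}) :
  surj f -> ses (submval (ker_submod f)) f.
Proof.
move=> sf; split=> [|//|x]; first exact: submval_inj.
split=> [fx|[y <-]]; last exact: (submvalP y).
by exists (insubm (ker_submod f) x); rewrite insubmK.
Qed.

(** With a section [s] of [e], the element [x - s (e x)] lies in the kernel of [e], hence comes from
    [K]. *)
Lemma ses_retraction K X P (i : {linear K -> X}) (e : {linear X -> P}) :
  ses i e -> projective P ->
  exists (r : {linear X -> K}) (s : {linear P -> X}),
    [/\ forall x, i (r x) = x - s (e x), forall x, r (i x) = x &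
        forall x, e (s x) = x].
Proof.
move=> S pP; have [inji se ex] := S; have [s sK] := projective_split pP se.
have fl : linear (fun x => x - s (e x)).
  by move=> a x y; rewrite !linearP addrACA -scalerDr.
have [|r rE] := @factor_inj _ _ _ i (linear_map fl) inji.
  by move=> y; apply/ex; rewrite /= linearB sK subrr.
exists r, s; split=> // x; apply: inji.
by rewrite rE /= (ses_comp0 S) linear0 subr0.
Qed.

Lemma projective_ses_mid K X P (i : {linear K -> X}) (e : {linear X -> P}) :
  ses i e -> projective P -> projective K -> projective X.
Proof.
move=> S pP pK; have [r [s [rE ri es]]] := ses_retraction S pP.
have l1 : linear (fun x : X => (r x, e x)) by move=> a x y; rewrite !linearP.
have l2 : linear (fun x : K * P => i x.1 + s x.2).
  by move=> a x y; rewrite /= !linearP addrACA scalerDr.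
apply: (@projective_retract _ _ (linear_map l1) (linear_map l2)) => [|x /=].
  exact: projective_prod.
by rewrite rE subrK.
Qed.

Lemma projective_ses_left K X P (i : {linear K -> X}) (e : {linear X -> P}) :
  ses i e -> projective P -> projective X -> projective K.
Proof.
move=> S pP pX; have [r [s [_ ri _]]] := ses_retraction S pP.
exact: (projective_retract pX ri).
Qed.

Lemma projective_iso P M (f : {linear P -> M}) :
  injective f -> surj f -> projective P -> projective M.
Proof.
move=> injf sf pP.
have [|g gE] := @factor_surj _ _ _ f idfun sf.
  by move=> x fx; apply: injf; rewrite linear0.
by apply: (@projective_retract _ _ g f pP) => x; have [y <-] := sf x; rewrite gE.
Qed.

(** Projective dimension by recursion on syzygies, the form in which the inductions below run. It
    agrees with [pd_le] for n >= 1. *)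
Fixpoint pdim_le (n : nat) M : Prop :=
  if n is n'.+1 then
    exists (K P : lmodType A) (i : {linear K -> P}) (e : {linear P -> M}),
      [/\ projective P, ses i e & pdim_le n' K]
  else projective M.

Lemma pdim_le_iso n M N (f : {linear M -> N}) :
  injective f -> surj f -> pdim_le n M -> pdim_le n N.
Proof.
case: n => [|n] injf sf; first exact: (projective_iso injf sf).
move=> [K [P [i [e [pP [inji se ex] nK]]]]].
exists K, P, i, (f \o e); split=> //; split=> // [y|x /=].
  by have [x <-] := sf y; have [z <-] := se x; exists z.
rewrite -ex; split=> [|->]; last exact: linear0.
by rewrite -[X in _ = X](linear0 f) => /injf.
Qed.

Lemma projective_zero M : (forall x : M, x = 0) -> projective M.
Proof.
move=> M0 N N' f g _.
have l : linear (fun _ : M => 0 : N) by move=> a x y; rewrite scaler0 addr0.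
by exists (linear_map l) => x; rewrite (M0 x) !linear0.
Qed.

Lemma pdim_leS n M : pdim_le n M -> pdim_le n.+1 M.
Proof.
elim: n M => [|n IH] M.
  move=> pM; exists (subm (ker_submod (idfun : {linear M -> M}))), M, (submval _), idfun.
  split=> //; first by apply: ses_ker => y; exists y.
  by apply: projective_zero => x; apply: submval_inj; rewrite linear0; apply: submvalP x.
by move=> [K [P [i [e [pP S nK]]]]]; exists K, P, i, e; split=> //; apply: IH.
Qed.

Lemma pdim_leW m n M : (m <= n)%N -> pdim_le m M -> pdim_le n M.
Proof.
move=> /subnK <-; elim: (n - m)%N => // k IH /IH; rewrite addSn; exact: pdim_leS.
Qed.

Lemma pdim_le_projective n M : projective M -> pdim_le n M.
Proof. exact: (@pdim_leW 0). Qed.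

(** If [F] covers [K] with kernel [L], then [F * P] covers [X], which is [K] plus a copy of [P],
    with the same kernel [L]. *)
Lemma pdim_le_ses_mid n K X P (i : {linear K -> X}) (e : {linear X -> P}) :
  ses i e -> projective P -> pdim_le n K -> pdim_le n X.
Proof.
case: n => [|n] S pP; first exact: projective_ses_mid S pP.
move=> [L [F [j [d [pF [injj sd dx] nL]]]]].
have [r [s [rE ri es]]] := ses_retraction S pP.
have ei := ses_comp0 S.
have l1 : linear (fun x : L => (j x, 0 : P)).
  by move=> a x y; rewrite linearP; congr (_, _); rewrite /= scaler0 addr0.
have l2 : linear (fun x : F * P => i (d x.1) + s x.2).
  by move=> a x y; rewrite /= !linearP addrACA scalerDr.
exists L, (F * P)%type, (linear_map l1), (linear_map l2); split=> //.
  exact: projective_prod.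
have [inji _ _] := S.
split=> [x y [/injj]//|x|[f p] /=].
  have [f fE] := sd (r x); exists (f, e x).
  by rewrite /= fE rE subrK.
split=> [h|[y [<- <-]]]; last first.
  by rewrite (proj2 (dx _)) ?linear0 ?addr0 //; exists y.
have p0 : p = 0 by have := congr1 e h; rewrite linearD ei es add0r linear0.
move: h; rewrite p0 linear0 addr0 -[X in _ = X](linear0 i) => /inji/dx[y <-].
by exists y.
Qed.

(** Let [F] cover [X] with kernel [L]. The kernel of the composite [F -> P] is projective because
    that map splits, and it covers [K] with the same kernel [L]. *)
Lemma pdim_le_ses_left n K X P (i : {linear K -> X}) (e : {linear X -> P}) :
  ses i e -> projective P -> pdim_le n X -> pdim_le n K.
Proof.
case: n => [|n] S pP; first exact: projective_ses_left S pP.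
move=> [L [F [j [d [pF [injj sd dx] nL]]]]].
have [inji se ex] := S.
pose h : {linear F -> P} := e \o d.
have sh : surj h.
  by move=> y; have [x <-] := se y; have [z <-] := sd x; exists z.
have [|i' i'E] := @factor_inj _ _ _ (submval (ker_submod h)) j (@submval_inj _ _ _ _).
  move=> y; exists (insubm _ (j y)); apply: insubmK; rewrite /h /=.
  by rewrite (proj2 (dx _)) ?linear0 //; exists y.
have [|d' d'E] := @factor_inj _ _ _ i (d \o submval (ker_submod h)) inji.
  by move=> y; apply/ex; apply: (submvalP y).
have {}d'E y : i (d' y) = d (submval _ y) by rewrite d'E.
exists L, (subm (ker_submod h)), i', d'; split=> //.
  exact: (projective_ses_left (ses_ker sh)).
split=> [x y exy|x|x].
- by apply: injj; rewrite -!i'E exy.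
- have [y yE] := sd (i x).
  exists (insubm _ y); apply: inji; rewrite d'E insubmK //.
  by rewrite /h /= yE; apply: ses_comp0 S x.
split=> [d'x|[y <-]].
  have /dx[y yE] : d (submval _ x) = 0 by rewrite -[LHS]d'E d'x linear0.
  by exists y; apply: (@submval_inj _ _ _ (ker_submod h)); rewrite i'E yE.
by apply: inji; rewrite d'E i'E linear0; apply/dx; exists y.
Qed.

(** The kernel of the projection [p'] of a pullback consists of the pairs (i k, 0). The pullback is
    given by its properties, so that the lemma applies to both projections of one module. *)
Lemma pullback_ses K P P' M X (i : {linear K -> P}) (e : {linear P -> M})
    (e' : {linear P' -> M}) (p : {linear X -> P}) (p' : {linear X -> P'}) :
  ses i e -> surj e' -> (forall x, e (p x) = e' (p' x)) ->
  (forall a b, e a = e' b -> exists2 x, p x = a & p' x = b) ->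
  (forall x, p x = 0 -> p' x = 0 -> x = 0) ->
  exists j : {linear K -> X}, ses j p'.
Proof.
move=> S se' comm pb inj; have [inji se ex] := S.
have E k : exists x, p x = i k /\ p' x = 0.
  by have [|x] := pb (i k) 0; [rewrite linear0 (ses_comp0 S)|exists x].
have inj2 x y : p x = p y -> p' x = p' y -> x = y.
  move=> e1 e2; apply/eqP; rewrite -subr_eq0; apply/eqP/inj.
    by rewrite linearB e1 subrr.
  by rewrite linearB e2 subrr.
have /choice[j jE] := E.
have jl : linear j.
  move=> a x y; apply: inj2; rewrite !linearP ?(jE _).1 ?(jE _).2 ?linearP //.
  by rewrite scaler0 addr0.
exists (linear_map jl); split=> [x y /= exy|b|x].
- by apply: inji; rewrite -(jE x).1 -(jE y).1 exy.
- by have [a aE] := se (e' b); have [x _ xE] := pb _ _ aE; exists x.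
split=> [p'x|[y <-]]; last exact: (jE y).2.
have /ex[k kE] : e (p x) = 0 by rewrite comm p'x linear0.
by exists k; apply: inj2; rewrite ?(jE k).1 ?(jE k).2.
Qed.

(* Schanuel's lemma: the pullback of two presentations of [M] is an extension
   of each projective by the kernel of the other presentation. *)
Lemma pdim_le_syzygy n K P M (i : {linear K -> P}) (e : {linear P -> M}) :
  ses i e -> projective P -> pdim_le n.+1 M -> pdim_le n K.
Proof.
move=> S pP [K' [P' [i' [e' [pP' S' nK']]]]].
have [_ se _] := S; have [_ se' _] := S'.
have hl : linear (fun x : P * P' => e x.1 - e' x.2).
  by move=> a x y; rewrite /= !linearP addrACA -scalerDr.
pose h := linear_map hl; pose X := subm (ker_submod h).
have pl : linear (fun x : X => (submval (ker_submod h) x).1).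
  by move=> a x y; rewrite linearP.
have pl' : linear (fun x : X => (submval (ker_submod h) x).2).
  by move=> a x y; rewrite linearP.
have comm (x : X) : e (linear_map pl x) = e' (linear_map pl' x).
  by apply/eqP; rewrite -subr_eq0; apply/eqP/(submvalP x).
have pb a b : e a = e' b ->
    exists2 x, linear_map pl x = a & linear_map pl' x = b.
  move=> eab; have sv : submval (ker_submod h) (insubm _ (a, b)) = (a, b).
    by rewrite insubmK //= eab subrr.
  by exists (insubm _ (a, b)); [exact: (congr1 fst sv)|exact: (congr1 snd sv)].
have inj x : linear_map pl x = 0 -> linear_map pl' x = 0 -> x = 0.
  move=> /= x1 x2; apply: (@submval_inj _ _ _ (ker_submod h)); rewrite linear0.
  by rewrite [submval _ x]surjective_pairing x1 x2.
have [j Sj] := pullback_ses S se' comm pb inj.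
have [|||j' Sj'] := pullback_ses (p := linear_map pl') (p' := linear_map pl) S' se.
- by move=> x; rewrite comm.
- by move=> a b eab; have [|x] := pb b a; rewrite ?eab //; exists x.
- by move=> x x2 x1; apply: inj.
apply: (pdim_le_ses_left Sj pP'); exact: (pdim_le_ses_mid Sj' pP).
Qed.

(* [pd_le M 0] never holds: its exactness condition at [P 0] excludes [e 0 = 0]. *)
Lemma pd_le0 M : ~ pd_le M 0.
Proof. by move=> [P [d [e [_ _ /(_ 0) e0 _ _]]]]; have [|//] := e0.1; apply: linear0. Qed.

Lemma pd_le_pdim_le n M : pd_le M n -> pdim_le n M.
Proof.
case: n => [/pd_le0//|n].
elim: n M => [|n IH] M [P [d [e [pP se e0 dx dl]]]];
  have S := ses_ker se; exists (subm (ker_submod e)), (P 0%N), (submval _), e;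
  (split=> //; first exact: pP);
  (* The first differential corestricts to a surjection [e'] onto the kernel of [e], so the tail of
     the resolution resolves this kernel. When the bound is 1, [e'] is an isomorphism. *)
  (have [|e' e'E] := @factor_inj _ _ _ (submval (ker_submod e)) (d 0%N) (@submval_inj _ _ _ _);
    first by move=> y; exists (insubm _ (d 0%N y)); apply: insubmK;
      apply/e0; split=> //; exists y);
  (have se' : surj e' by
    move=> x; have /e0[_ [y yE]] := submvalP x; exists y;
    apply: (@submval_inj _ _ _ (ker_submod e)); rewrite e'E);
  have e'0 x : e' x = 0 <-> d 0%N x = 0 by
    rewrite -e'E; split=> [->|h]; [exact: linear0|];
    apply: (@submval_inj _ _ _ (ker_submod e)); rewrite h linear0.
  apply: (projective_iso _ se' (pP 1%N isT)) => x y exy; apply/eqP.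
  rewrite -subr_eq0; apply/eqP/(dl 0%N) => //.
  by apply/e'0; rewrite linearB exy subrr.
apply: IH; exists (fun k => P k.+1), (fun k => d k.+1), e'; split=> //.
- by move=> k kn; apply: pP.
- by move=> x; rewrite e'0 dx //; split=> [|[]].
- by move=> k kn x; apply: dx.
- by move=> m nE x; apply: dl; rewrite nE.
Qed.

Lemma pdim_le_pd_le n M : pdim_le n.+1 M -> pd_le M n.+1.
Proof.
elim: n M => [|n IH] M [K [P0 [i [e [pP S]]]]]; have [inji se ex] := S.
  move=> /= pK.
  have l (X : lmodType A) : linear (fun _ : K => 0 : X).
    by move=> a x y; rewrite scaler0 addr0.
  (* Beyond degree 1 the modules and zero maps are placeholders, on which [pd_le M 1] imposes no
     condition. *)
  pose P' k := if k is k'.+1 then K else P0.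
  pose d' k : {linear P' k.+1 -> P' k} :=
    if k is k'.+1 return {linear P' k.+1 -> P' k} then linear_map (l K) else i.
  exists P', d', e; split=> //.
  - by case.
  - by move=> x; rewrite ex; split=> [|[]].
  - case=> // _ x dx; apply: inji; rewrite linear0; exact: dx.
move=> /IH[P [d [e' [pP' se' e'0 dx dl]]]].
pose P' k := if k is k'.+1 then P k' else P0.
pose d' k : {linear P' k.+1 -> P' k} :=
  if k is k'.+1 return {linear P' k.+1 -> P' k} then d k'
  else i \o e' : {linear P 0%N -> P0}.
have ie' x : i (e' x) = 0 <-> e' x = 0.
  split=> [|->]; last exact: linear0.
  by rewrite -[X in _ = X](linear0 i) => /inji.
exists P', d', e; split=> //.
- by case=> [|k] //; apply: pP'.
- move=> x; rewrite ex; split=> [[y <-]|[_ [y <-]]].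
    by split=> //; have [z <-] := se' y; exists z.
  by exists (e' y).
- case=> [_|k kn] x; last exact: dx.
  by rewrite /d' /= ie' e'0; split=> [[]|].
- by case=> [|m] // [nE]; apply: dl; rewrite nE.
Qed.

End ProjDim.

(** * Free modules on a set and their coordinate submodules *)

Section FreeModule.
Variables (A : comPzRingType) (X : choiceType).
Implicit Types N : lmodType A.

Definition finite_support (f : X -> A^o) : Prop :=
  exists s : seq X, forall x, f x != 0 -> x \in s.

Lemma finite_support_submod : submod finite_support.
Proof.
split=> [|a f g [s sf] [t tg]]; first by exists [::] => x; rewrite eqxx.
exists (s ++ t) => x; rewrite mem_cat; apply: contraR; rewrite negb_or.
move=> /andP[xs xt]; have [fx gx] : f x = 0 /\ g x = 0.
  by split; apply/eqP; [apply: contraNT xs => /sf|apply: contraNT xt => /tg].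
by rewrite -[X in X == _]/(a *: f x + g x) fx gx scaler0 addr0.
Qed.

Definition freem : lmodType A := subm finite_support_submod.

Definition fun_of_freem (f : freem) : X -> A^o := submval finite_support_submod f.

Fact coefm_linear x : linear (fun f => fun_of_freem f x).
Proof. by move=> a f g; rewrite /fun_of_freem linearP. Qed.
Definition coefm (x : X) : {linear freem -> A^o} := linear_map (coefm_linear x).

Lemma freemP (f g : freem) : (forall x, coefm x f = coefm x g) -> f = g.
Proof. by move=> fg; apply: submval_inj; apply/funext. Qed.

(** A chosen finite list containing the support, possibly with further points; by [freem_liftE] the
    sums over it do not depend on the choice. *)
Definition supp (f : freem) : seq X := undup (projT1 (cid (@submvalP _ _ _ finite_support_submod f))).

Lemma supp_uniq f : uniq (supp f).
Proof. exact: undup_uniq. Qed.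

Lemma mem_supp f x : coefm x f != 0 -> x \in supp f.
Proof. by rewrite /supp mem_undup => h; case: cid => s /= ->. Qed.

Lemma coefm_notin f x : x \notin supp f -> coefm x f = 0.
Proof. by move=> xf; apply/eqP; apply: contraNT xf; apply: mem_supp. Qed.

Definition freem_lift N (g : X -> N) (f : freem) : N :=
  \sum_(x <- supp f) coefm x f *: g x.

Lemma freem_liftE N (g : X -> N) f s :
  uniq s -> (forall x, coefm x f != 0 -> x \in s) ->
  freem_lift g f = \sum_(x <- s) coefm x f *: g x.
Proof.
move=> us sP.
have E t : \sum_(x <- t) coefm x f *: g x =
    \sum_(x <- [seq y <- t | coefm y f != 0]) coefm x f *: g x.
  rewrite big_filter [RHS]big_mkcond; apply: eq_bigr => x _.
  by case: eqP => [->|]; rewrite ?scale0r.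
rewrite /freem_lift E [RHS]E; apply: perm_big; apply: uniq_perm.
- exact/filter_uniq/supp_uniq.
- exact: filter_uniq.
move=> x; rewrite !mem_filter; case: (boolP (coefm x f != 0)) => //= h.
by rewrite mem_supp // sP.
Qed.

Fact freem_lift_linear N (g : X -> N) : linear (freem_lift g).
Proof.
move=> a f f'.
pose s := undup (supp f ++ supp f').
have sl x : coefm x f != 0 -> x \in s.
  by move=> h; rewrite mem_undup mem_cat (mem_supp h).
have sr x : coefm x f' != 0 -> x \in s.
  by move=> h; rewrite mem_undup mem_cat (mem_supp h) orbT.
have sD x : coefm x (a *: f + f') != 0 -> x \in s.
  apply: contraR => xs; rewrite linearP.
  have /eqP-> : coefm x f == 0 by apply: contraR xs => /sl.
  have /eqP-> : coefm x f' == 0 by apply: contraR xs => /sr.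
  by rewrite scaler0 addr0.
rewrite !(@freem_liftE _ _ _ s) ?undup_uniq // scaler_sumr -big_split.
apply: eq_bigr => x _; rewrite (linearP (coefm x)) scalerDl scalerA //.
Qed.
Definition freem_ext N (g : X -> N) : {linear freem -> N} :=
  linear_map (freem_lift_linear g).

Fact delta_fun_fin x : finite_support (fun y => (y == x)%:R).
Proof. by exists [:: x] => y; rewrite inE; case: (y =P x) => // _; rewrite eqxx. Qed.
Definition deltam (x : X) : freem := insubm finite_support_submod (fun y => (y == x)%:R : A^o).

Lemma coefm_delta x y : coefm y (deltam x) = (y == x)%:R.
Proof.
rewrite -[LHS]/(submval finite_support_submod (deltam x) y) insubmK //; exact: delta_fun_fin.
Qed.

Lemma freem_ext_delta N (g : X -> N) x : freem_ext g (deltam x) = g x.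
Proof.
rewrite -[LHS]/(freem_lift g (deltam x)) (@freem_liftE _ _ _ [:: x]) // => [|y].
  by rewrite big_seq1 coefm_delta eqxx scale1r.
by rewrite coefm_delta inE; case: (y =P x) => // _; rewrite eqxx.
Qed.

Lemma freem_delta f : f = \sum_(x <- supp f) coefm x f *: deltam x.
Proof.
apply: freemP => y; rewrite linear_sum.
under eq_bigr do rewrite linearZ_LR coefm_delta.
case: (boolP (y \in supp f)) => yf.
  rewrite (bigD1_seq y) ?supp_uniq //= eqxx big1 ?addr0; first by rewrite [RHS]mulr1.
  by move=> x xy; rewrite eq_sym (negPf xy); apply: mulr0.
rewrite coefm_notin // big_seq big1 // => x xf; case: (y =P x) => [e|_]; last exact: mulr0.
by rewrite e xf in yf.
Qed.

Lemma freem_linearE N (h : {linear freem -> N}) f :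
  h f = \sum_(x <- supp f) coefm x f *: h (deltam x).
Proof.
rewrite [X in h X]freem_delta linear_sum.
by apply: eq_bigr => x _; rewrite linearZ.
Qed.

Lemma freem_eq N (h1 h2 : {linear freem -> N}) :
  (forall x, h1 (deltam x) = h2 (deltam x)) -> h1 =1 h2.
Proof.
move=> h12 f; rewrite !freem_linearE.
by apply: eq_bigr => x _; rewrite h12.
Qed.

Lemma freem_projective : projective freem.
Proof.
move=> M N f g sf.
have /choice[c cE] : forall x, exists y, f y = g (deltam x) by move=> x; apply: sf.
exists (freem_ext c) => x; apply: (freem_eq (h1 := f \o freem_ext c)) => y.
by rewrite -[LHS]/(f (freem_ext c (deltam y))) freem_ext_delta.
Qed.

Definition supported (D : X -> Prop) (f : freem) : Prop :=
  forall x, coefm x f != 0 -> D x.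

Lemma supported_submod D : submod (supported D).
Proof.
split=> [x|a f g Df Dg x]; first by rewrite linear0 eqxx.
case: (eqVneq (coefm x f) 0) => [fx|/Df//].
case: (eqVneq (coefm x g) 0) => [gx|/Dg//].
by rewrite linearP fx gx scaler0 addr0 eqxx.
Qed.

Lemma supported_delta (D : X -> Prop) x : D x -> supported D (deltam x).
Proof. by move=> Dx y; rewrite coefm_delta; case: (y =P x) => [->|_]; rewrite ?eqxx. Qed.

Definition restrictm (D : X -> Prop) : {linear freem -> freem} :=
  freem_ext (fun x => if `[<D x>] then deltam x else 0).

Lemma coefm_restrict D f y :
  coefm y (restrictm D f) = if `[<D y>] then coefm y f else 0.
Proof.
have l : linear (fun f => if `[<D y>] then coefm y f else 0).
  by move=> a u v; case: ifP => _; rewrite ?linearP // scaler0 addr0.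
apply: (freem_eq (h1 := coefm y \o restrictm D) (h2 := linear_map l)) => x.
rewrite -[LHS]/(coefm y (restrictm D (deltam x))) freem_ext_delta [RHS](_ : _ = if `[<D y>] then (y == x)%:R else 0).
  case: (eqVneq y x) => [<-|yx].
    by case: ifP => _; [rewrite coefm_delta eqxx|exact: linear0].
  have -> : coefm y (if `[<D x>] then deltam x else 0) = 0.
    by case: ifP => _; [rewrite coefm_delta (negPf yx)|exact: linear0].
  by case: ifP.
by rewrite -[LHS]/(if `[<D y>] then coefm y (deltam x) else 0) coefm_delta.
Qed.

Lemma restrictm_supported (D : X -> Prop) f : supported D (restrictm D f).
Proof. by move=> x; rewrite coefm_restrict; case: asboolP => //; rewrite eqxx. Qed.

Lemma restrictm_id (D : X -> Prop) f : supported D f -> restrictm D f = f.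
Proof.
move=> Df; apply: freemP => x; rewrite coefm_restrict; case: asboolP => // nD.
by case: (eqVneq (coefm x f) 0) => [//|/Df].
Qed.

(** The coordinate projection [restrictm D] makes this submodule a direct summand of the free
    module. *)
Lemma supported_projective D : projective (subm (supported_submod D)).
Proof.
have [|r rE] := @factor_inj _ _ _ _ (submval (supported_submod D)) (restrictm D)
  (@submval_inj _ _ _ _).
  move=> f; exists (insubm _ (restrictm D f)); apply: insubmK.
  exact: restrictm_supported.
apply: (projective_retract (s := submval _) (p := r) freem_projective) => x.
apply: submval_inj; rewrite rE restrictm_id //; exact: submvalP.
Qed.

Lemma freem_ext_supported N (g g' : X -> N) D f : supported D f ->
  (forall x, D x -> g x = g' x) -> freem_ext g f = freem_ext g' f.
Proof.
move=> Df gg'; apply: eq_bigr => x _.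
by case: (eqVneq (coefm x f) 0) => [->|/Df/gg'->//]; rewrite !scale0r.
Qed.

End FreeModule.
Arguments deltam {A X}.
Arguments coefm {A X}.
Arguments restrictm {A X}. Arguments supp {A X}.

(** * Well-ordered filtrations and Auslander's lemma *)

Section Auslander.
Variable A : comPzRingType.
Implicit Types M N P Q K : lmodType A.

(* [q] exhibits [Q] as the subquotient [S / T]; nothing is required of [q]
   outside [S]. *)
Definition subquotient M (S T : M -> Prop) Q (q : M -> Q) : Prop :=
  [/\ forall a x y, S x -> S y -> q (a *: x + y) = a *: q x + q y,
      forall u, exists2 x, S x & q x = u &
      forall x, S x -> (q x = 0 <-> T x)].

Section SubquotientTheory.
Variables (M Q : lmodType A) (S T : M -> Prop) (q : M -> Q).
Hypotheses (hS : submod S) (qP : subquotient S T q).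

Fact subquotient_linear : linear (fun x => q (submval hS x)).
Proof. by have [ql _ _] := qP => a x y; rewrite linearP ql //; apply: submvalP. Qed.

Lemma subquotient0 : q 0 = 0.
Proof.
have [ql _ _] := qP; have := ql (-1) 0 0 hS.1 hS.1.
by rewrite scaler0 addr0 scaleN1r addNr.
Qed.

Lemma subquotientD x y : S x -> S y -> q (x + y) = q x + q y.
Proof. by move=> Sx Sy; have [ql _ _] := qP; rewrite -[x]scale1r ql // !scale1r. Qed.

Lemma subquotientB x y : S x -> S y -> q (x - y) = q x - q y.
Proof.
move=> Sx Sy; have [ql _ _] := qP.
by rewrite addrC -scaleN1r ql // scaleN1r addrC.
Qed.

Lemma subquotient_section : projective Q ->
  exists s : {linear Q -> M}, forall u, S (s u) /\ q (s u) = u.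
Proof.
move=> pQ; have [_ qs _] := qP.
have [|s sE] := projective_split (e := linear_map subquotient_linear) pQ.
  by move=> u; have [x Sx <-] := qs u; exists (insubm hS x) => /=; congr q; apply: insubmK.
exists (submval hS \o s) => u; split; first exact: submvalP.
exact: sE.
Qed.

Lemma coefmZ_sub f x : supported S f -> S (coefm x f *: x).
Proof.
move=> Sf; case: (eqVneq (coefm x f) 0) => [->|/Sf]; last exact: submodZ.
by rewrite scale0r; apply: hS.1.
Qed.

Lemma freem_ext_id_sub f : supported S f -> S (freem_ext id f).
Proof. by move=> Sf; apply: submod_sum => // x; apply: coefmZ_sub. Qed.

Lemma freem_ext_subquotient f :
  supported S f -> freem_ext q f = q (freem_ext id f).
Proof.
move=> Sf; have St x : S (coefm x f *: x) by apply: coefmZ_sub.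
rewrite /freem_ext /= /freem_lift; elim: (supp f) => [|x s IH].
  by rewrite !big_nil subquotient0.
rewrite !big_cons subquotientD ?IH //; last exact: submod_sum.
congr (_ + _); case: (eqVneq (coefm x f) 0) => [->|/Sf Sx].
  by rewrite !scale0r subquotient0.
have [ql _ _] := qP; have := ql (coefm x f) x 0 Sx hS.1.
by rewrite subquotient0 !addr0.
Qed.

End SubquotientTheory.

Variables (I : Type) (R : I -> I -> Prop).
Hypotheses (wfR : well_founded R) (totR : forall i j, R i j \/ i = j \/ R j i).

Lemma wf_min (P : I -> Prop) :
  (exists i, P i) -> exists i, P i /\ forall j, R j i -> ~ P j.
Proof.
move=> [i]; elim/(well_founded_ind wfR): i => i IH Pi.
have [[j [Rj Pj]]|nj] := pselect (exists j, R j i /\ P j); first exact: (IH j).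
by exists i; split=> // j Rj Pj; apply: nj; exists j.
Qed.

Definition filtration M (S : I -> M -> Prop) : Prop :=
  [/\ forall i, submod (S i), forall i j x, R j i -> S j x -> S i x &
      forall x, exists i, S i x].

(** The union of the earlier steps; the clause [x = 0] keeps it a submodule when [i] has no
    predecessor. Dividing by this union treats successor and limit indices alike. *)
Definition below M (S : I -> M -> Prop) i (x : M) : Prop :=
  x = 0 \/ exists2 j, R j i & S j x.

Section Filtration.
Variables (M : lmodType A) (S : I -> M -> Prop).
Hypothesis filS : filtration S.

Lemma filtration_common x y : exists i, S i x /\ S i y.
Proof.
have [_ mono cov] := filS; have [i Sx] := cov x; have [j Sy] := cov y.
have [Rij|[eij|Rji]] := totR i j.
- by exists j; split=> //; apply: mono Rij Sx.
- by exists i; rewrite {2}eij.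
- by exists i; split=> //; apply: mono Rji Sy.
Qed.

Lemma below_sub i x : below S i x -> S i x.
Proof.
have [sS mono _] := filS; case=> [->|[j Rj Sx]]; first exact: (sS i).1.
exact: mono Rj Sx.
Qed.

Lemma below_common i x y : below S i x -> below S i y ->
  (x = 0 /\ y = 0) \/ exists j, [/\ R j i, S j x & S j y].
Proof.
have [sS mono _] := filS.
case=> [->|[j Rj Sx]] [->|[k Rk Sy]]; first by left.
- by right; exists k; split=> //; apply: (sS k).1.
- by right; exists j; split=> //; apply: (sS j).1.
right; have [Rjk|[ejk|Rkj]] := totR j k.
- by exists k; split=> //; apply: mono Rjk Sx.
- by exists j; split=> //; rewrite ejk.
- by exists j; split=> //; apply: mono Rkj Sy.
Qed.

(** A finite support meets finitely many steps of the chain, and the largest of them contains it.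
    The case [f = 0] allows for an empty [J]. *)
Lemma supported_chain (J : I -> Prop) (f : freem A M) :
  supported (fun x => exists2 j, J j & S j x) f ->
  f = 0 \/ exists2 j, J j & supported (S j) f.
Proof.
have [sS mono _] := filS => Jf.
suff: (forall x, x \in supp f -> coefm x f = 0) \/
      exists2 j, J j & forall x, x \in supp f -> coefm x f != 0 -> S j x.
  case=> [f0|[j Jj jf]]; [left|right].
    apply: freemP => x; rewrite linear0; case: (boolP (x \in supp f)) => [/f0//|].
    exact: coefm_notin.
  by exists j => // x fx; apply: jf => //; apply: mem_supp.
elim: (supp f) => [|x s [IH|[j Jj IH]]]; first by left.
  case: (eqVneq (coefm x f) 0) => fx.
    by left=> y; rewrite inE => /orP[/eqP->//|]; apply: IH.
  have [j Jj Sx] := Jf x fx; right; exists j => // y.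
  by rewrite inE => /orP[/eqP->//|/IH->]; rewrite eqxx.
case: (eqVneq (coefm x f) 0) => fx.
  right; exists j => // y; rewrite inE => /orP[/eqP->|]; last exact: IH.
  by rewrite fx eqxx.
have [k Jk Sx] := Jf x fx; right.
have [Rjk|[ejk|Rkj]] := totR j k.
- exists k => // y; rewrite inE => /orP[/eqP->//|ys fy].
  exact: mono Rjk (IH y ys fy).
- by exists k => // y; rewrite inE -ejk => /orP[/eqP->|]; [rewrite ejk|apply: IH].
- exists j => // y; rewrite inE => /orP[/eqP-> _|]; last exact: IH.
  exact: mono Rkj Sx.
Qed.

(* Recursion on the least index [rk x] with [S (rk x) x]: subtracting from [x]
   its component [phi (rk x) x] in the chosen complement lowers the rank. *)
Lemma filtered_projective :
  (forall i, exists Q (q : M -> Q),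
     subquotient (S i) (below S i) q /\ projective Q) ->
  projective M.
Proof.
move=> sq B C f g sf; have [sS mono cov] := filS.
(* On [S i], [p.1] is the projection onto a complement of [below S i] given by a section of the
   quotient map, and [p.2] lifts [g \o p.1] along [f]. *)
have : forall i, exists p : (M -> M) * (M -> B),
    [/\ forall a x y, S i x -> S i y -> p.1 (a *: x + y) = a *: p.1 x + p.1 y,
        forall a x y, S i x -> S i y -> p.2 (a *: x + y) = a *: p.2 x + p.2 y,
        forall x, S i x -> below S i (x - p.1 x),
        forall x, below S i x -> p.1 x = 0 /\ p.2 x = 0 &
        forall x, S i x -> f (p.2 x) = g (p.1 x)].
  move=> i; have [Q [q [qP pQ]]] := sq i; have [ql qs qk] := qP.
  have [s sP] := subquotient_section (sS i) qP pQ.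
  have [k kE] := pQ B C f (g \o s) sf.
  exists (s \o q, k \o q); split=> /= [a x y Sx Sy|a x y Sx Sy|x Sx|x bx|x Sx].
  - by rewrite ql // linearP.
  - by rewrite ql // linearP.
  - have [Ss qsE] := sP (q x); apply/qk; first exact: submodB.
    by rewrite (subquotientB qP) // qsE subrr.
  - by rewrite (proj2 (qk x (below_sub bx)) bx) !linear0.
  - by rewrite kE.
move=> /choice[p pP]; pose phi i := (p i).1; pose psi i := (p i).2.
have /choice[rk rkP] : forall x, exists i, S i x /\ forall j, R j i -> ~ S j x.
  by move=> x; apply: wf_min; apply: cov.
pose lt x y := R (rk x) (rk y).
have wflt : well_founded lt by apply: wf_inverse_image.
pose st x := x - phi (rk x) x.
(* The recursive call is made only if the rank drops. If it does not drop, the remainder [st x] is 0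
   and the default value 0 is the right one. *)
pose F x (h : forall y, lt y x -> B) : B :=
  psi (rk x) x + (if pselect (lt (st x) x) is left l then h _ l else 0).
pose h := Fix wflt (fun _ => B) F.
have h_unfold x :
    h x = psi (rk x) x + (if pselect (lt (st x) x) then h (st x) else 0).
  rewrite {1}/h Fix_eq => [|y u v uv]; rewrite /F; last by case: pselect => // l; rewrite uv.
  by case: pselect.
have irr x : ~ lt x x.
  by elim/(well_founded_ind wflt): x => x IH xx; apply: (IH x xx xx).
have h0 : h 0 = 0.
  have [_ _ _ /(_ 0) b0 _] := pP (rk 0).
  have [e1 e2] := b0 (or_introl (erefl 0)).
  rewrite h_unfold /st /psi /phi e1 e2 subr0 add0r.
  by case: pselect => // l; case: (irr 0).
have h_rk x : h x = psi (rk x) x + h (x - phi (rk x) x).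
  rewrite h_unfold -/(st x); congr (_ + _).
  have bx : below S (rk x) (st x).
    by have [_ _ bl _ _] := pP (rk x); apply: bl; have [] := rkP x.
  case: pselect => //= nl; case: bx => [->//|[j Rj Sj]].
  have [_ m] := rkP (st x); case: nl; rewrite /lt.
  have [//|[e|Rs]] := totR (rk (st x)) (rk x).
    by case: (m j); rewrite ?e.
  by case: (m _ Rs); apply: mono Rj Sj.
(* The recursion equation holds at every index [i] with [S i x], since [phi i] and [psi i] vanish on
   elements of smaller rank. Two elements can thus be expanded at a common index, which gives
   linearity. *)
have h_step i x : S i x -> h x = psi i x + h (x - phi i x).
  move=> Sx; have [Rx|[<-//|Rx]] := totR (rk x) i; last by case: ((rkP x).2 i Rx).
  have [_ _ _ /(_ x) bx _] := pP i.
  have [e1 e2] := bx (or_intror (ex_intro2 _ _ _ Rx (rkP x).1)).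
  by rewrite /psi /phi e1 e2 add0r subr0.
have h_lin i a x y : S i x -> S i y -> h (a *: x + y) = a *: h x + h y.
  elim/(well_founded_ind wfR): i a x y => i IH a x y Sx Sy.
  have [l1 l2 bl _ _] := pP i.
  rewrite (h_step i) ?(h_step i x) ?(h_step i y) //; last exact: (sS i).2.
  rewrite /phi /psi l1 // l2 // opprD addrACA -scalerBr.
  suff -> : h (a *: (x - (p i).1 x) + (y - (p i).1 y)) =
      a *: h (x - (p i).1 x) + h (y - (p i).1 y).
    by rewrite scalerDr addrACA.
  have [[-> ->]|[j [Rj Sj Sj']]] := below_common (bl x Sx) (bl y Sy).
    by rewrite scaler0 addr0 h0 scaler0 addr0.
  exact: IH Rj _ _ _ Sj Sj'.
have hl : linear h.
  by move=> a x y; have [i [Sx Sy]] := filtration_common x y; apply: h_lin Sx Sy.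
exists (linear_map hl) => x /=; have [i Sx] := cov x.
elim/(well_founded_ind wfR): i x Sx => i IH x Sx.
have [_ _ /(_ x Sx) bl _ /(_ x Sx) fp] := pP i.
rewrite (h_step i) // linearD [f _]fp -[X in _ = g X](subrK (phi i x)) [RHS]linearD addrC.
congr (_ + _); case: bl => [->|[j Rj Sj]]; last exact: IH Rj _ Sj.
by rewrite h0 !linear0.
Qed.

End Filtration.

(** Dimension shifting in the free cover on all elements of [M]: the combinations supported in [S i]
    map onto [S i], so the kernel of the cover is filtered with quotients that are syzygies of the
    quotients of [M]. *)
Lemma auslander n M (S : I -> M -> Prop) : filtration S ->
  (forall i, exists Q (q : M -> Q),
     subquotient (S i) (below S i) q /\ pdim_le n Q) ->
  pdim_le n M.
Proof.
elim: n M S => [|n IH] M S filS; first exact: filtered_projective filS.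
move=> sq; have [sS mono cov] := filS.
pose e : {linear freem A M -> M} := freem_ext id.
have se : surj e by move=> x; exists (deltam x); apply: freem_ext_delta.
pose K : lmodType A := subm (ker_submod e).
exists K, (freem A M), (submval (ker_submod e)), e.
split; [exact: freem_projective|exact: ses_ker|].
pose iK : {linear K -> freem A M} := submval (ker_submod e).
pose S' i (k : K) := supported (S i) (iK k).
apply: (IH _ S'); first split.
- move=> i; have [z l] := @supported_submod A M (S i).
  by split=> [|a x y Sx Sy]; rewrite /S' ?linear0 // linearP; apply: l.
- by move=> i j k Rj Sk x /Sk; apply: mono.
- move=> k; have [|f0|[j _ Sj]] := supported_chain filS (J := fun=> True) (f := iK k).
  + by move=> x _; have [j Sx] := cov x; exists j.
  + have [i _] := cov 0; exists i; rewrite /S' f0; exact: (@supported_submod A M (S i)).1.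
  + by exists j.
move=> i; have [Q [q [qP nQ]]] := sq i; have [ql qs qk] := qP.
pose low x := exists2 j, R j i & S j x.
(* The basis elements new at step [i]. The free module on them is the i-th quotient of the
   filtration of the free cover, and it maps onto [Q]. *)
pose D x := S i x /\ ~ low x.
pose P : lmodType A := subm (supported_submod A D).
pose iP := submval (supported_submod A D).
pose ed : {linear P -> Q} := freem_ext q \o iP.
have edE p : ed p = freem_ext q (iP p) by [].
have low_sub x : low x -> S i x by case=> j Rj; apply: mono.
have sed : surj ed.
  move=> u; have [x Sx <-] := qs u; have [lx|nlx] := pselect (low x).
    by exists 0; rewrite linear0 (proj2 (qk x Sx)) //; right.
  exists (insubm _ (deltam x)); rewrite edE /iP insubmK ?freem_ext_delta //.
  exact: supported_delta.
pose Q' : lmodType A := subm (ker_submod ed).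
have nQ' : pdim_le n Q'.
  by apply: (pdim_le_syzygy (ses_ker sed)) nQ; apply: supported_projective.
pose iQ := submval (ker_submod ed).
pose r (k : K) : P := insubm (supported_submod A D) (restrictm D (iK k)).
have rE k : iP (r k) = restrictm D (iK k).
  by rewrite /iP insubmK //; apply: restrictm_supported.
have rl a x y : r (a *: x + y) = a *: r x + r y.
  by apply: submval_inj; rewrite -/iP linearP !rE !linearP.
(* The coordinates dropped by [restrictm D] sit at elements of lower steps, where [q] vanishes; so
   the value is [q (e f)], and [e f = 0]. *)
have rker k : S' i k -> ed (r k) = 0.
  move=> Sk; rewrite edE rE.
  set f := iK k; have ef : e f = 0 by apply: (submvalP k).
  have -> : freem_ext q (restrictm D f) = freem_ext q f.
    apply/eqP; rewrite eq_sym -subr_eq0 -linearB; apply/eqP.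
    rewrite (@freem_ext_supported _ _ _ _ (fun=> 0) low).
    - by apply: big1 => x _; rewrite scaler0.
    - move=> x; rewrite linearB coefm_restrict; case: asboolP => [_|nD].
        by rewrite subrr eqxx.
      rewrite subr0 => /Sk Sx; apply: contrapT => nlx; exact: nD.
    - by move=> x lx; apply/qk; [exact: low_sub|right].
  rewrite (freem_ext_subquotient (sS i) qP) // -/e ef.
  exact: (subquotient0 (sS i) qP).
exists Q', (fun k => insubm (ker_submod ed) (r k)); split=> //; split.
- move=> a x y Sx Sy; rewrite rl; apply: submval_inj.
  rewrite linearP !insubmK //; try exact: rker.
  by rewrite linearP !rker // scaler0 addr0.
- move=> u; pose f := iP (iQ u).
  have Df : supported D f by apply: submvalP.
  have Sf : supported (S i) f by move=> x /Df[].
  have qf : q (e f) = 0.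
    rewrite -(freem_ext_subquotient (sS i) qP Sf); exact: (submvalP u).
  have Sef : S i (e f) by apply: freem_ext_id_sub.
  (* Since [q (e f) = 0], the element [e f] lies in a lower step and is also the image of some [f']
     supported there. Then [f - f'] is in the kernel of [e] and has the same [D]-coordinates as
     [f]. *)
  have [f' f'l ef'] : exists2 f', supported low f' & e f' = e f.
    have [ef0|lef] := proj1 (qk _ Sef) qf.
      by exists 0; [exact: (@supported_submod A M low).1|rewrite linear0 ef0].
    by exists (deltam (e f)); [exact: supported_delta|exact: freem_ext_delta].
  have ek : e (f - f') = 0 by rewrite linearB ef' subrr.
  have Sk : S' i (insubm (ker_submod e) (f - f')).
    rewrite /S' /iK insubmK //; apply: (submodB (supported_submod A (S i))) => //.
    by move=> x /f'l/low_sub.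
  exists (insubm _ (f - f')) => //; apply: submval_inj.
  rewrite insubmK; last exact: rker.
  apply: submval_inj; rewrite -/iP rE insubmK // linearB restrictm_id //.
  suff -> : restrictm D f' = 0 by rewrite subr0.
  apply: freemP => x; rewrite coefm_restrict linear0; case: asboolP => // -[_ nlx].
  by case: (eqVneq (coefm x f') 0) => // /f'l.
- move=> k Sk; have E : insubm (ker_submod ed) (r k) = 0 <-> restrictm D (iK k) = 0.
    rewrite -rE; split=> [h|h].
      have /(congr1 iQ) := h; rewrite /iQ insubmK; last exact: rker.
      by rewrite linear0 => ->; rewrite linear0.
    apply: submval_inj; rewrite insubmK; last exact: rker.
    by apply: submval_inj; rewrite -/iP h !linear0.
  rewrite E; split=> [rk0|].
    have [|k0|[j Rj Sj]] := supported_chain filS (J := fun j => R j i) (f := iK k).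
    + move=> x kx; apply: contrapT => nlx.
      have := coefm_restrict D (iK k) x; rewrite rk0 linear0.
      case: asboolP => [_ kx0|[]]; last by split=> //; apply: Sk.
      by rewrite -kx0 eqxx in kx.
    + by left; apply: submval_inj; rewrite k0 linear0.
    + by right; exists j.
  case=> [->|[j Rj Sj]]; first by rewrite !linear0.
  apply: freemP => x; rewrite coefm_restrict linear0; case: asboolP => // -[_ nlx].
  case: (eqVneq (coefm x (iK k)) 0) => // /Sj Sx; case: nlx; by exists j.
Qed.

End Auslander.

(** * Bounds by cyclic modules and by finitely generated submodules *)

Section GlobalDimension.
Variable A : comPzRingType.
Implicit Types M N P Q K X Y Z : lmodType A.

Lemma submod_image K M (i : {linear K -> M}) : submod (fun x => exists y, i y = x).
Proof.
split=> [|a x y [u <-] [v <-]]; first by exists 0; rewrite linear0.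
by exists (a *: u + v); rewrite linearP.
Qed.

(** An extension is a filtration of length two, with the image of [X] at [false] and all of [Y] at
    [true]; [auslander] then replaces the horseshoe lemma. *)
Lemma pdim_le_ses_ext n X Y Z (i : {linear X -> Y}) (e : {linear Y -> Z}) :
  ses i e -> pdim_le n X -> pdim_le n Z -> pdim_le n Y.
Proof.
move=> [inji se ex] nX nZ.
pose R (b c : bool) := ~~ b /\ c.
pose S (b : bool) (y : Y) := b \/ exists x, i x = y.
have wfR : well_founded R.
  have wf0 : Acc R false by split=> b [_].
  by case; [split; case=> [[]|_]|exact: wf0].
apply: (@auslander A bool R wfR _ n Y S).
- by move=> [] []; [right; left|right; right|left|right; left].
- split=> [b|b c x [_ cT] _|x]; [|by left; case: b cT|by exists true; left].
  split; first by right; exists 0; rewrite linear0.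
  move=> a x y [bT|[u <-]] [bT'|[v <-]]; try by left.
  by right; exists (a *: u + v); rewrite linearP.
case.
  exists Z, e; split=> //; split=> [a x y _ _|u|x _]; first exact: linearP.
    by have [x <-] := se u; exists x => //; left.
  rewrite ex; split=> [h|[->|[[] [] // _ _ []//]]]; last by exists 0; rewrite linear0.
  by right; exists false => //; right.
have /choice[r rE] : forall y, exists x, (exists x, i x = y) -> i x = y.
  move=> y; have [[x xy]|nx] := pselect (exists x, i x = y); first by exists x.
  by exists 0.
have ri x : r (i x) = x by apply: inji; apply: rE; exists x.
exists X, r; split=> //; split=> [a _ _ [//|[x <-]] [//|[y <-]]|u|_ [//|[x <-]]].
- by rewrite -linearP !ri.
- by exists (i u) => //; right; exists u.
- rewrite ri; split=> [->|[h|[b []//]]]; first by left; rewrite linear0.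
  by apply: inji; rewrite h linear0.
Qed.

(** A projective cover [F] of [Y] also covers [Z], and the kernel of [F -> Z] is an extension of [X]
    by the kernel of [F -> Y]. Raising the bound on [Y] by one yields such an [F] even for
    [n = 0]. *)
Lemma pdim_le_ses_quot n X Y Z (i : {linear X -> Y}) (e : {linear Y -> Z}) :
  ses i e -> pdim_le n X -> pdim_le n Y -> pdim_le n.+1 Z.
Proof.
move=> [inji se ex] nX /pdim_leS[L [F [j [d [pF [injj sd dx] nL]]]]].
pose h : {linear F -> Z} := e \o d.
have hE y : h y = e (d y) by [].
have sh : surj h.
  by move=> z; have [y <-] := se z; have [f <-] := sd y; exists f.
exists (subm (ker_submod h)), F, (submval _), h; split=> //; first exact: ses_ker.
have [|i' i'E] := @factor_inj _ _ _ _ (submval (ker_submod h)) j (@submval_inj _ _ _ _).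
  move=> y; exists (insubm _ (j y)); apply: insubmK.
  by rewrite hE (proj2 (dx _)) ?linear0 //; exists y.
have [|d' d'E] := @factor_inj _ _ _ _ i (d \o submval (ker_submod h)) inji.
  by move=> y; apply/ex; apply: (submvalP y).
have {}d'E y : i (d' y) = d (submval _ y) by rewrite d'E.
apply: (@pdim_le_ses_ext n _ _ _ i' d' _ nL nX); split=> [x y exy|x|x].
- by apply: injj; rewrite -!i'E exy.
- have [y yE] := sd (i x); exists (insubm _ y); apply: inji; rewrite d'E insubmK //.
  by rewrite hE yE; apply/ex; exists x.
split=> [d'x|[y <-]].
  have /dx[y yE] : d (submval _ x) = 0 by rewrite -[LHS]d'E d'x linear0.
  by exists y; apply: (@submval_inj _ _ _ (ker_submod h)); rewrite i'E yE.
by apply: inji; rewrite d'E i'E linear0; apply/dx; exists y.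
Qed.

Lemma subquotient_exists M (S T : M -> Prop) :
  submod S -> submod T -> (forall x, T x -> S x) ->
  exists Q (q : M -> Q), subquotient S T q.
Proof.
move=> hS hT TS.
have hT' : submod (fun x : subm hS => T (submval hS x)).
  split=> [|a x y Tx Ty]; first by rewrite linear0; apply: hT.1.
  by rewrite linearP; apply: hT.2.
exists (quotm hT'), (fun x => quotmap hT' (insubm hS x)).
split=> [a x y Sx Sy|u|x Sx].
- by rewrite insubm_linear // linearP.
- have [x <-] := quotmap_surj u; exists (submval hS x); first exact: (submvalP x).
  by rewrite submvalK.
- by rewrite quotmap_ker insubmK.
Qed.

(** Quantifying over all embeddings with image [T] makes the bound expressible without a proof of
    [submod T] and stable under equivalence of predicates. *)
Definition pdim_sub_le n M (T : M -> Prop) : Prop :=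
  forall Q (j : {linear Q -> M}), injective j ->
    (forall x, T x <-> exists y, j y = x) -> pdim_le n Q.

Lemma pdim_sub_le_subm n M (T : M -> Prop) (hT : submod T) :
  pdim_sub_le n T <-> pdim_le n (subm hT).
Proof.
have Tim x : T x <-> exists y, submval hT y = x.
  by split=> [Tx|[y <-]]; [exists (insubm hT x); rewrite insubmK|apply: (submvalP y)].
split=> [h|h Q j injj jT]; first exact: (h _ (submval hT) (@submval_inj _ _ _ hT)).
have [|g gE] := @factor_inj _ _ _ _ j (submval hT) injj.
  by move=> y; apply/jT; apply: (submvalP y).
apply: (pdim_le_iso (f := g) _ _ h) => [x y exy|y].
  by apply: (@submval_inj _ _ _ hT); rewrite -!gE exy.
have Tj : T (j y) by apply/jT; exists y.
by exists (insubm hT (j y)); apply: injj; rewrite gE insubmK.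
Qed.

Lemma pdim_sub_leW m n M (T : M -> Prop) :
  (m <= n)%N -> pdim_sub_le m T -> pdim_sub_le n T.
Proof. by move=> mn h Q j injj jT; apply: pdim_leW mn _; apply: h jT. Qed.

Lemma pdim_sub_le_ext n M (T T' : M -> Prop) :
  (forall x, T x <-> T' x) -> pdim_sub_le n T -> pdim_sub_le n T'.
Proof. by move=> TT' h Q j injj jT; apply: (h Q j) => // x; rewrite TT'. Qed.

Lemma pdim_le_subquotient n M (S T : M -> Prop) Q (q : M -> Q) :
  submod S -> submod T -> (forall x, T x -> S x) -> subquotient S T q ->
  pdim_sub_le n S -> pdim_sub_le n T -> pdim_le n.+1 Q.
Proof.
move=> hS hT TS qP /pdim_sub_le_subm-/(_ hS) nS /pdim_sub_le_subm-/(_ hT) nT.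
have [ql qs qk] := qP.
have [|j jE] := @factor_inj _ _ _ _ (submval hS) (submval hT) (@submval_inj _ _ _ hS).
  by move=> y; exists (insubm hS (submval hT y)); apply/insubmK/TS; apply: (submvalP y).
pose e := linear_map (subquotient_linear (hS := hS) qP).
have eE x : e x = q (submval hS x) by [].
apply: (@pdim_le_ses_quot n _ _ _ j e _ nT nS); split=> [x y exy|u|x].
- by apply: (@submval_inj _ _ _ hT); rewrite -!jE exy.
- by have [x Sx <-] := qs u; exists (insubm hS x); rewrite eE insubmK.
rewrite eE qk; last exact: (submvalP x).
split=> [Tx|[y <-]]; last by rewrite jE; apply: (submvalP y).
by exists (insubm hT (submval hS x)); apply: (@submval_inj _ _ _ hS); rewrite jE insubmK.
Qed.

Definition span M (G : M -> Prop) (x : M) : Prop :=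
  forall S, submod S -> (forall y, G y -> S y) -> S x.

Lemma span_submod M (G : M -> Prop) : submod (span G).
Proof.
by split=> [S hS _|a x y Gx Gy S hS GS]; [exact: hS.1|apply: hS.2; [apply: Gx|apply: Gy]].
Qed.

Lemma mem_span M (G : M -> Prop) x : G x -> span G x.
Proof. by move=> Gx S _; apply. Qed.

Lemma span_min M (G S : M -> Prop) : submod S -> (forall y, G y -> S y) ->
  forall x, span G x -> S x.
Proof. by move=> hS GS x; apply. Qed.

Lemma span_sub M (G G' : M -> Prop) : (forall x, G x -> span G' x) ->
  forall x, span G x -> span G' x.
Proof. by move=> GG'; apply: span_min => //; apply: span_submod. Qed.

Section Chain.
Variables (I : Type) (R : I -> I -> Prop).
Hypothesis totR : forall i j, R i j \/ i = j \/ R j i.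

Lemma submod_chain_union M (S : I -> M -> Prop) (J : I -> Prop) :
  (forall i, submod (S i)) -> (forall i j x, R j i -> S j x -> S i x) ->
  (exists j, J j) -> submod (fun x => exists2 j, J j & S j x).
Proof.
move=> sS mono [j0 Jj0]; split=> [|a x y [i Ji Sx] [j Jj Sy]].
  by exists j0 => //; apply: (sS j0).1.
have [Rij|[eij|Rji]] := totR i j.
- by exists j => //; apply: (sS j).2 => //; apply: mono Rij Sx.
- by exists i => //; apply: (sS i).2 => //; rewrite eij.
- by exists i => //; apply: (sS i).2 => //; apply: mono Rji Sy.
Qed.

Lemma below_submod M (S : I -> M -> Prop) i :
  filtration R S -> submod (below R S i).
Proof.
move=> filS; have [sS mono _] := filS; split=> [|a x y bx by_]; first by left.
have [[-> ->]|[j [Rj Sx Sy]]] := below_common totR filS bx by_.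
  by left; rewrite scaler0 addr0.
by right; exists j => //; apply: (sS j).2.
Qed.

End Chain.

(** The strict part of the relation given by the well-ordering principle is well founded: otherwise
    the inaccessible elements would have a least member. *)
Lemma well_order_exists (T : eqType) : exists R : T -> T -> Prop,
  [/\ well_founded R, forall x y z, R x y -> R y z -> R x z &
      forall x y, R x y \/ x = y \/ R y x].
Proof.
have [R woR] := well_ordering_principle T.
have woT : wo_chain R predT by apply: withinW.
have totR : total R by move=> x y; apply: (wo_chainW woT).
have antR x y : R x y -> R y x -> x = y.
  by move=> xy yx; apply: (wo_chain_antisymmetric woT) => //; rewrite xy.
have minR (P : T -> Prop) : (exists x, P x) -> exists2 z, P z & forall x, P x -> R z x.
  move=> [x Px]; have [|z [[/asboolP Pz zmin] _]] := woR (fun x => `[<P x>]).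
    by exists x; apply/asboolP.
  by exists z => // y Py; apply: zmin; apply/asboolP.
have trR x y z : R x y -> R y z -> R x z.
  move=> xy yz; have [|w Pw wmin] := minR (fun t => [\/ t = x, t = y | t = z]).
    by exists x; constructor 1.
  have [wx wy wz] : [/\ R w x, R w y & R w z].
    by split; apply: wmin; [constructor 1|constructor 2|constructor 3].
  case: Pw => e; subst w => //; first by rewrite (antR x y).
  by rewrite -(antR y z).
exists (fun x y => R x y /\ x <> y); split=> [x|x y z [xy nxy] [yz nyz]|x y].
- apply: contrapT => nacc.
  have [|z nz zmin] := minR (fun x => ~ Acc (fun x y => R x y /\ x <> y) x).
    by exists x.
  apply: nz; split=> y [yz nyz]; apply: contrapT => /zmin zy.
  exact/nyz/antR.
- by split; [apply: trR yz|move=> e; apply: nxy; apply: antR => //; rewrite e].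
- have [->|nxy] := pselect (x = y); first by right; left.
  by case/orP: (totR x y) => h; [left|right; right]; split=> // e; apply: nxy.
Qed.

(* Auslander's theorem: every module is filtered by cyclic ones. *)
Lemma pdim_le_cyclic n :
  (forall I (Q : lmodType A) (q : {linear A^o -> Q}), @is_ideal A I -> surj q ->
     (forall x, q x = 0 <-> I x) -> pdim_le n Q) ->
  forall M, pdim_le n M.
Proof.
move=> cyc M; have [R [wfR trR totR]] := well_order_exists M.
pose S x := span (fun y => R y x \/ y = x).
have filS : filtration R S.
  split=> [x|x y v Ryx|x]; first exact: span_submod.
    apply: span_sub => z Rz; apply: mem_span; left.
    by case: Rz => [Rzy|->//]; apply: trR Ryx.
  by exists x; apply: mem_span; right.
apply: (auslander wfR totR filS) => x; have hb := below_submod totR x filS.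
have [sS _ _] := filS.
have bS := @below_sub _ _ _ _ _ filS x.
have [Q [q qP]] := subquotient_exists (sS x) hb bS.
exists Q, q; split=> //; have [ql qs qk] := qP.
have Sxx : S x x by apply: mem_span; right.
(* Step [x] is the sum of the earlier steps and the multiples of [x], so its quotient is cyclic,
   generated by the class of [x]. *)
have decomp v : S x v -> exists2 a, S x (a *: x) & below R S x (v - a *: x).
  apply: (span_min (S := fun v => exists2 a, S x (a *: x) & below R S x (v - a *: x))) => [|y [Ry|->]].
  - split=> [|c u w [a Sa bu] [b Sb bw]].
      by exists 0; rewrite scale0r ?subr0; [exact: (sS x).1|left].
    exists (c * a + b); first by rewrite scalerDl -scalerA; apply: (sS x).2.
    by rewrite scalerDl -scalerA opprD addrACA -scalerBr; apply: hb.2.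
  - exists 0; rewrite scale0r ?subr0; first exact: (sS x).1.
    by right; exists y => //; apply: mem_span; right.
  - by exists 1; rewrite scale1r // subrr; left.
have Sa a : S x (a *: x) by apply: (submodZ (sS x)).
have pl : linear (fun a : A^o => q (a *: x)).
  by move=> c a b; rewrite scalerDl -scalerA ql.
apply: (cyc (fun a => q (a *: x) = 0) Q (linear_map pl)) => //.
  split=> [|a b qa qb|a b qb]; first by rewrite -(linear0 (linear_map pl)).
    by rewrite scalerDl (subquotientD qP) // qa qb addr0.
  by rewrite -scalerA -[_ *: _]addr0 ql ?qb ?scaler0 ?add0r;
    [exact: (subquotient0 (sS x) qP)| |exact: (sS x).1].
move=> u; have [v Sv <-] := qs u; have [a _ bv] := decomp v Sv.
exists a => /=; apply/eqP; rewrite eq_sym -subr_eq0 -(subquotientB qP) //.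
by apply/eqP/qk => //; apply: (submodB (sS x)).
Qed.

(** The list [l] collects the single generators split off from the family during the induction on
    its cardinality. *)
Definition family_span M (T : Type) (g : T -> M) (l : seq M) : M -> Prop :=
  span (fun x => (exists t, x = g t) \/ x \in l).

(** Each aleph costs one dimension. Along a well-order of [T] with smaller initial segments, each
    step and the union of its predecessors have dimension at most [n + k] by induction, so each
    quotient has dimension at most [n + k + 1], and [auslander] applies. *)
Lemma pdim_family_span n M k (T : Type) (g : T -> M) (l : seq M) :
  (forall s : seq M, pdim_sub_le n (span (fun x => x \in s))) ->
  le_aleph k T -> pdim_sub_le (n + k) (family_span g l).
Proof.
move=> fgM; elim: k T g l => [|k IH] T g l.
  move=> [s sT]; rewrite addn0.
  apply: pdim_sub_le_ext (fgM (map g s ++ l)) => x.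
  have gs t : g t \in map g s.
    have := sT t; elim: (s) => //= y r IHr [->|/IHr]; rewrite inE ?eqxx // => ->.
    exact: orbT.
  split; apply: span_sub => y; last first.
    by case=> [[t ->]|yl]; apply: mem_span; rewrite mem_cat ?gs ?yl ?orbT.
  rewrite mem_cat => /orP[ys|yl]; apply: mem_span; last by right.
  left; elim: (s) ys => //= t r IHr; rewrite inE => /orP[/eqP->|/IHr//].
  by exists t.
move=> [R [wfR trR totR leR]].
(* For empty [T] no step of the filtration would exist to contain [l]; the span is then finitely
   generated. *)
have [[t0 _]|noT] := pselect (exists t : T, True); last first.
  apply: pdim_sub_le_ext (pdim_sub_leW (leq_addr k.+1 n) (fgM l)) => x.
  split; apply: span_sub => y; first by move=> yl; apply: mem_span; right.
  by case=> [[t _]|yl]; [case: noT; exists t|apply: mem_span].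
rewrite addnS; apply/(pdim_sub_le_subm _ (span_submod _)).
set hN := span_submod _; pose N : lmodType A := subm hN.
pose iN : {linear N -> M} := submval hN.
pose low t := family_span (fun y : {y | R y t} => g (sval y)).
(* Moving [g t] into the list expresses the step up to and including [t] over the same initial
   segment as the step before it, so one induction hypothesis bounds both. *)
pose U t := low t (g t :: l).
have U_g t : U t (g t) by apply: mem_span; right; rewrite inE eqxx.
have U_l t x : x \in l -> U t x by move=> xl; apply: mem_span; right; rewrite inE xl orbT.
have U_low t : forall s, R s t -> forall x, U s x -> low t l x.
  move=> s Rst; apply: span_sub => y [[[z Rzs] ->]|].
    by apply: mem_span; left; exists (exist _ z (trR _ _ _ Rzs Rst)).
  rewrite inE => /orP[/eqP->|yl]; apply: mem_span; last by right.
  by left; exists (exist _ s Rst).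
have low_U t x : low t l x -> U t x.
  by apply: span_sub => y [[s ->]|yl]; apply: mem_span; [left; exists s|right; rewrite inE yl orbT].
have U_mono t s x : R s t -> U s x -> U t x.
  by move=> Rst /(U_low t s Rst)/low_U.
have U_N t x : U t x -> family_span g l x.
  apply: span_sub => y [[s ->]|]; first by apply: mem_span; left; exists (sval s).
  by rewrite inE => /orP[/eqP->|yl]; apply: mem_span; [left; exists t|right].
have sU t : submod (U t) by apply: span_submod.
pose S t (x : N) := U t (iN x).
have filS : filtration R S.
  split=> [t|t s x Rst|x].
  - split=> [|a x y Sx Sy]; first by rewrite /S linear0; apply: (sU t).1.
    by rewrite /S linearP; apply: (sU t).2.
  - exact: U_mono.
  have := submvalP x; rewrite -/(iN x) => Nx.
  suff [t _ Ut] : exists2 t, True & U t (iN x) by exists t.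
  apply: (span_min (S := fun v => exists2 t, True & U t v)) Nx => [|y [[t ->]|yl]]; first exact: (submod_chain_union totR).
    by exists t.
  by exists t0 => //; apply: U_l.
apply: (auslander wfR totR filS) => t.
have hb := below_submod totR t filS; have [sS _ _] := filS.
have bS := @below_sub _ _ _ _ _ filS t.
have [Q [q qP]] := subquotient_exists (sS t) hb bS.
exists Q, q; split=> //.
have im (V : M -> Prop) : (forall x, V x -> family_span g l x) ->
    pdim_sub_le (n + k) V -> pdim_sub_le (n + k) (fun x : N => V (iN x)).
  move=> VN nV B j injj jV; apply: (nV B (iN \o j)).
    by move=> x y /= /(@submval_inj _ _ _ hN)/injj.
  move=> x; split=> [Vx|[y <-]]; last by apply/jV; exists y.
  have Nx := VN x Vx; have xE : iN (insubm hN x) = x by apply: insubmK.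
  have /jV[y yE] : V (iN (insubm hN x)) by rewrite xE.
  by exists y; rewrite -[LHS]/(iN (j y)) yE.
apply: (pdim_le_subquotient (sS t) hb bS qP).
  by apply: (im (U t)); [exact: U_N|exact: (IH _ _ _ (leR t))].
have [[s Rst]|nos] := pselect (exists s, R s t).
  apply: pdim_sub_le_ext (im (low t l) _ (IH _ _ _ (leR t))) => x; last first.
    by move=> /low_U/U_N.
  split=> [lx|[->|[r Rr /(U_low t r Rr)//]]]; last first.
    by rewrite linear0; apply: (span_submod _).1.
  right; suff [r Rr Ur] : exists2 r, R r t & U r (iN x) by exists r.
  apply: (span_min (S := fun v => exists2 r, R r t & U r v)) lx => [|y [[[r Rr] ->]|yl]].
  - by apply: (submod_chain_union totR) => //; exists s.
  - by exists r.
  - by exists s => //; apply: U_l.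
(* Here [t] is minimal and the lower part is zero. *)
move=> B j injj jb; apply/pdim_le_projective/projective_zero => x.
apply: injj; rewrite linear0; have /jb[//|[r Rr _]] : exists y, j y = j x by exists x.
by case: nos; exists r.
Qed.

End GlobalDimension.

(** * Matrices: generalized inverses, syzygies and exactness after tensoring *)

Lemma det_regular_nz (R : comNzRingType) p q (B : 'M[R]_(p, q)) (H : 'M_(q, p)) U :
  B *m H *m B = U *m B -> exists H' : 'M_(q, p), \det U *: B = B *m H' *m B.
Proof.
case: p B H U => [|p] B H U BHB.
  by exists 0; rewrite (flatmx0 B) !mul0mx scaler0.
(* Since [U *m B] has the form [B *m H *m B], only the constant term of [f] survives modulo matrices
   of this form. For [f = char_poly U] the left side vanishes by Cayley-Hamilton, and the constant
   term is the determinant up to sign. *)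
have E (f : {poly R}) : exists H' : 'M_(q, p.+1),
    horner_mx U f *m B = f.[0] *: B + B *m H' *m B.
  elim/poly_ind: f => [|f c [H' IH]].
    by exists 0; rewrite rmorph0 horner0 scale0r mulmx0 !mul0mx addr0.
  exists (f.[0] *: H + H' *m B *m H).
  rewrite rmorphD rmorphM /= horner_mx_X horner_mx_C -mulmxE mulmxDl.
  rewrite -mulmxA -BHB !mulmxA IH hornerMXaddC mulr0 add0r [LHS]addrC mul_scalar_mx.
  congr (_ + _); rewrite mulmxDr !mulmxDl -!scalemxAl -!scalemxAr -!scalemxAl.
  by rewrite !mulmxA.
have [H' HE] := E (char_poly U).
exists (- (-1) ^+ p.+1 *: H').
rewrite -scalemxAr -scalemxAl scaleNr; apply/eqP; rewrite -addr_eq0; apply/eqP.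
move: HE; rewrite Cayley_Hamilton mul0mx horner_coef0 char_poly_det => HE.
rewrite -[RHS](scaler0 _ ((-1) ^+ p.+1)) [X in _ = _ *: X]HE scalerDr scalerA.
by rewrite mulrA -expr2 sqrr_sign mul1r.
Qed.

Section Matrices.
Variable A : comPzRingType.
Implicit Types M N P Q K : lmodType A.

(* With [U] congruent to [1] modulo a maximal ideal, this says that [B] becomes
   von Neumann regular after inverting one element outside that ideal. *)
Lemma det_regular p q (B : 'M[A]_(p, q)) (H : 'M_(q, p)) U :
  (1 : A) != 0 ->
  B *m H *m B = U *m B -> exists H' : 'M_(q, p), \det U *: B = B *m H' *m B.
Proof.
move=> A1.
(* [A] is repackaged as a nonzero ring with the same operations, as [det_regular_nz] requires. *)
pose R : comNzRingType := HB.pack (A : Type) (GRing.PzSemiRing_isNonZero.Build A A1) (GRing.ComPzRing.class A).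
exact: (@det_regular_nz R p q B H U).
Qed.

(** Coherence presents the ideal on generators [g'] that need not be [g]. Writing [G' = P *m g] and
    [g = Q *m G'] transports the relations to [g]. *)
Lemma coherent_relations n (g : 'cV[A]_n) : coherent A ->
  exists m (Z : 'M[A]_(m, n)), forall v : 'rV_n, v *m g = 0 <-> exists w, v = w *m Z.
Proof.
move=> coh; pose I x := exists v : 'rV_n, x%:M = v *m g.
have IE x : I x <-> exists c : 'I_n -> A, x = \sum_(i < n) c i * g i 0.
  split=> [[v xE]|[c ->]].
    exists (v 0); have := congr1 (fun X : 'M_1 => X 0 0) xE.
    by rewrite !mxE eqxx mulr1n.
  exists (\row_i c i); apply/matrixP => i j; rewrite !ord1 !mxE eqxx mulr1n.
  by apply: eq_bigr => k _; rewrite mxE.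
have idI : is_ideal I.
  split=> [|x y [v vE] [w wE]|r x [v vE]].
  - by exists 0; rewrite mul0mx raddf0.
  - by exists (v + w); rewrite mulmxDl -vE -wE raddfD.
  - by exists (r *: v); rewrite -scalemxAl -vE scale_scalar_mx.
have [|n' [g' [g'I [m [r rP]]]]] := coh I idI.
  by exists n, (fun i => g i 0).
pose G' : 'cV[A]_n' := \col_i g' i; pose Z0 : 'M[A]_(m, n') := \matrix_(j, i) r j i.
have g'E (v : 'rV_n') : v *m G' = (\sum_i v 0 i * g' i)%:M.
  apply/matrixP => i j; rewrite !ord1 !mxE eqxx mulr1n.
  by apply: eq_bigr => k _; rewrite mxE.
have Z0P (v : 'rV_n') : v *m G' = 0 <-> exists w, v = w *m Z0.
  rewrite g'E; split=> [h|[w ->]].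
    have /rP[d dE] : \sum_i v 0 i * g' i = 0.
      by have := congr1 (fun X : 'M_1 => X 0 0) h; rewrite !mxE eqxx mulr1n.
    exists (\row_j d j); apply/rowP => i; rewrite dE mxE.
    by apply: eq_bigr => j _; rewrite !mxE.
  rewrite (proj2 (rP _)) ?raddf0 //; exists (w 0) => i; rewrite mxE.
  by apply: eq_bigr => j _; rewrite mxE.
have [P PE] : exists P : 'M_(n', n), G' = P *m g.
  have /choice[P PE] : forall i, exists v : 'rV_n, (g' i)%:M = v *m g.
    move=> i; apply/g'I; exists (fun j => (j == i)%:R).
    rewrite (bigD1 i) //= eqxx mul1r big1 ?addr0 // => j ji.
    by rewrite (negPf ji) mul0r.
  exists (\matrix_i P i); apply/row_matrixP => i.
  rewrite row_mul rowK -PE; apply/matrixP => j k.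
  by rewrite !ord1 !mxE eqxx mulr1n.
have [Q QE] : exists Q : 'M_(n, n'), g = Q *m G'.
  have /choice[Q QE] : forall i, exists v : 'rV_n', (g i 0)%:M = v *m G'.
    move=> i; have /g'I[c cE] : I (g i 0).
      apply/IE; exists (fun j => (j == i)%:R).
      rewrite (bigD1 i) //= eqxx mul1r big1 ?addr0 // => j ji.
      by rewrite (negPf ji) mul0r.
    exists (\row_j c j); rewrite g'E cE; congr (_%:M).
    by apply: eq_bigr => j _; rewrite mxE.
  exists (\matrix_i Q i); apply/row_matrixP => i.
  rewrite row_mul rowK -QE; apply/matrixP => j k.
  by rewrite !ord1 !mxE eqxx mulr1n.
(* Indeed v = v (1 - Q P) + (v Q) P, and v Q is a relation on [g'] whenever v is one on [g]. *)
exists (n + m)%N, (col_mx (1%:M - Q *m P) (Z0 *m P)) => v; split=> [vg|[w ->]].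
  have /Z0P[w wE] : v *m Q *m G' = 0 by rewrite -mulmxA -QE.
  exists (row_mx v w); rewrite mul_row_col mulmxBr mulmx1 !mulmxA wE subrK //.
rewrite -[w]hsubmxK mul_row_col mulmxDl -!mulmxA mulmxBl mul1mx -mulmxA -PE -QE subrr.
rewrite mulmx0 add0r mulmxA; apply/Z0P; by exists (rsubmx w).
Qed.

(** Induction on the columns: the solutions for [B'] are the combinations of the rows of [Z], and
    the remaining column [b] asks that the coefficients form a relation between the entries of
    [Z *m b]. *)
Lemma coherent_ker p q (B : 'M[A]_(p, q)) : coherent A ->
  exists m (Z : 'M[A]_(m, p)), forall v : 'rV_p, v *m B = 0 <-> exists w, v = w *m Z.
Proof.
move=> coh; elim: q B => [|q IH] B.
  exists p, 1%:M => v; split=> [_|_]; last by rewrite thinmx0.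
  by exists v; rewrite mulmx1.
suff key (b : 'cV[A]_p) (B' : 'M[A]_(p, q)) : exists m (Z : 'M[A]_(m, p)),
    forall v : 'rV_p, v *m row_mx b B' = 0 <-> exists w, v = w *m Z.
  have := key (lsubmx (B : 'M_(p, 1 + q))) (rsubmx (B : 'M_(p, 1 + q))).
  by rewrite hsubmxK.
have [m [Z ZP]] := IH B'; have [m' [Z' Z'P]] := coherent_relations (Z *m b) coh.
exists m', (Z' *m Z) => v; rewrite mul_mx_row; split=> [h|[w ->]].
  have [vb /ZP[w wE]] : v *m b = 0 /\ v *m B' = 0.
    by apply: eq_row_mx; rewrite h row_mx0.
  have /Z'P[w' w'E] : w *m (Z *m b) = 0 by rewrite mulmxA -wE.
  by exists w'; rewrite mulmxA -w'E.
have -> : w *m (Z' *m Z) *m b = 0.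
  by rewrite mulmxA -mulmxA; apply/Z'P; exists w.
rewrite (proj2 (ZP _)) ?row_mx0 //; exists (w *m Z'); exact: mulmxA.
Qed.

(** The row vector [v] with entries in [M] times [B], that is, the map [M^p -> M^q] obtained by
    tensoring right multiplication by [B] with [M]. *)
Definition mx_act M p q (B : 'M[A]_(p, q)) (v : 'I_p -> M) (j : 'I_q) : M :=
  \sum_i B i j *: v i.

Lemma mx_act_linear M N (f : {linear M -> N}) p q (B : 'M[A]_(p, q)) v j :
  f (mx_act B v j) = mx_act B (fun i => f (v i)) j.
Proof. by rewrite linear_sum; apply: eq_bigr => i _; rewrite linearZ. Qed.

Lemma mx_actM M p q r (B : 'M[A]_(p, q)) (C : 'M[A]_(q, r)) (v : 'I_p -> M) j :
  mx_act (B *m C) v j = mx_act C (mx_act B v) j.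
Proof.
rewrite /mx_act; under [RHS]eq_bigr do rewrite scaler_sumr.
rewrite exchange_big; apply: eq_bigr => i _; rewrite mxE scaler_suml.
by apply: eq_bigr => k _; rewrite scalerA mulrC.
Qed.

Lemma mx_actB M p q (B : 'M[A]_(p, q)) (v w : 'I_p -> M) j :
  mx_act B (fun i => v i - w i) j = mx_act B v j - mx_act B w j.
Proof. by rewrite -sumrB; apply: eq_bigr => i _; rewrite scalerBr. Qed.

Definition mx_exact p q r (C : 'M[A]_(p, q)) (B : 'M[A]_(q, r)) : Prop :=
  forall v : 'rV_q, v *m B = 0 <-> exists w, v = w *m C.

Lemma mx_exact_mul0 p q r (C : 'M[A]_(p, q)) (B : 'M[A]_(q, r)) :
  mx_exact C B -> C *m B = 0.
Proof.
move=> CB; apply/row_matrixP => i; rewrite row_mul row0.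
by apply/CB; exists (delta_mx 0 i); rewrite rowE.
Qed.

(** The kernel of [M^q -> M^r] lies in the image of [M^p -> M^q]. For consecutive matrices of a free
    resolution this is the vanishing of a Tor module. *)
Definition tensor_exact M p q r (C : 'M[A]_(p, q)) (B : 'M[A]_(q, r)) : Prop :=
  forall v : 'I_q -> M, (forall j, mx_act B v j = 0) ->
  exists w, forall i, v i = mx_act C w i.

(** A projective module is a retract of a free one, where the linear system separates into one
    system over [A] per coordinate. The finite list [t] contains all coordinates that occur. *)
Lemma tensor_exact_projective P p q r (C : 'M[A]_(p, q)) (B : 'M[A]_(q, r)) :
  projective P -> mx_exact C B -> tensor_exact P C B.
Proof.
move=> pP CB v vB; pose e : {linear freem A P -> P} := freem_ext id.
have [|s sE] := projective_split (e := e) pP.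
  by move=> x; exists (deltam x); apply: freem_ext_delta.
have /choice[w wE] : forall x, exists w, \row_i coefm x (s (v i)) = w *m C.
  move=> x; apply/CB/rowP => j; rewrite !mxE.
  rewrite -[RHS](linear0 (coefm x)) -(linear0 s) -(vB j) !mx_act_linear.
  by apply: eq_bigr => i _; rewrite mxE [LHS]mulrC.
pose t := undup (flatten [seq supp (s (v i)) | i <- enum 'I_q]).
exists (fun k => \sum_(x <- t) w x 0 k *: x) => i.
rewrite -[LHS]sE -[LHS]/(freem_lift id (s (v i))) (@freem_liftE _ _ _ _ _ t) ?undup_uniq //.
  rewrite /mx_act; under [RHS]eq_bigr do rewrite scaler_sumr.
  rewrite exchange_big; apply: eq_bigr => x _.
  have -> : coefm x (s (v i)) = (w x *m C) 0 i by rewrite -wE mxE.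
  rewrite mxE scaler_suml; apply: eq_bigr => k _.
  by rewrite scalerA mulrC.
move=> x xi; rewrite mem_undup; apply/flattenP; exists (supp (s (v i))).
  by apply: map_f; rewrite mem_enum.
exact: mem_supp.
Qed.

(* Dimension shifting: the homology of the complex [D] tensored with a module of
   projective dimension at most [n] vanishes beyond degree [n]. *)
Lemma tensor_exact_pdim (r : nat -> nat) (D : forall i, 'M[A]_(r i.+1, r i)) :
  (forall i, mx_exact (D i.+1) (D i)) ->
  forall n M, pdim_le n M -> forall i, (n <= i)%N -> tensor_exact M (D i.+1) (D i).
Proof.
move=> exD; elim=> [|n IH] M.
  by move=> pM i _; apply: tensor_exact_projective.
move=> [K [P [j [e [pP [injj se ex] nK]]]]] [//|i] ni v vD.
have /choice[u uE] : forall k, exists x, e x = v k by move=> k; apply: se.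
have /choice[x xE] : forall k, exists y, j y = mx_act (D i.+1) u k.
  move=> k; apply/ex; rewrite mx_act_linear -[RHS](vD k).
  by apply: eq_bigr => l _; rewrite uE.
have [w wE] : exists w, forall k, x k = mx_act (D i.+1) w k.
  apply: (IH K nK i ni) => k; apply: injj; rewrite linear0 mx_act_linear.
  transitivity (mx_act (D i) (mx_act (D i.+1) u) k).
    by apply: eq_bigr => l _; rewrite xE.
  rewrite -mx_actM (mx_exact_mul0 (exD i)).
  by apply: big1 => l _; rewrite mxE scale0r.
(* Subtracting [j (w k)] turns the lift [u] of [v] into a cycle over [P] without changing its image
   in [M]. *)
have [|z zE] := tensor_exact_projective pP (exD i.+1) (v := fun k => u k - j (w k)).
  move=> k; rewrite mx_actB -mx_act_linear -wE xE subrr //.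
exists (fun k => e (z k)) => k; rewrite -mx_act_linear -zE linearB uE.
by rewrite (proj2 (ex _)) ?subr0 //; exists (w k).
Qed.

End Matrices.

(** * Reduction modulo maximal ideals and passage from local to global *)

Section Maximal.
Variable A : comPzRingType.
Implicit Types M N P Q K : lmodType A.

Lemma ideal_submod (I : A -> Prop) : is_ideal I <-> @submod A A^o I.
Proof.
split=> [[I0 ID IM]|hI]; first by split=> // a x y Ix Iy; apply: ID => //; apply: IM.
split; first exact: hI.1.
  exact: (submodD hI).
exact: (submodZ hI).
Qed.

Lemma maximal_ideal_exists (J : A -> Prop) : is_ideal J -> ~ J 1 ->
  exists m : A -> Prop, maximal_ideal m /\ forall x, J x -> m x.
Proof.
move=> idJ J1.
(* joining with [J] makes the empty chain harmless *)
pose hull (X : set A) : A -> Prop := fun a => X a \/ J a.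
have [|X [[idX X1] maxX]] := @Zorn_bigcup A (fun X => is_ideal (hull X) /\ ~ hull X 1).
  move=> F FP totF; split; last by case=> // -[X FX X1]; have [_ []] := FP X FX; left.
  have common a b : hull (\bigcup_(X in F) X)%classic a ->
      hull (\bigcup_(X in F) X)%classic b ->
      (J a /\ J b) \/ exists X, [/\ F X, hull X a & hull X b].
    case=> [[X FX Xa]|Ja] [[Y FY Yb]|Jb]; first 1 last.
    - by right; exists X; split=> //; [left|right].
    - by right; exists Y; split=> //; [right|left].
    - by left.
    right; have [XY|YX] := totF X Y FX FY.
      by exists Y; split=> //; left=> //; apply: XY.
    by exists X; split=> //; left=> //; apply: YX.
  have up X a : F X -> hull X a -> hull (\bigcup_(X in F) X)%classic a.
    by move=> FX [Xa|Ja]; [left; exists X|right].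
  have [J0 JD JM] := idJ.
  split=> [|a b ha hb|r a ha]; first by right.
    have [[Ja Jb]|[X [FX Xa Xb]]] := common a b ha hb; first by right; apply: JD.
    by apply: (up X) => //; have [[_ XD _] _] := FP X FX; apply: XD.
  have [[Ja _]|[X [FX Xa _]]] := common a a ha ha; first by right; apply: JM.
  by apply: (up X) => //; have [[_ _ XM] _] := FP X FX; apply: XM.
exists (hull X); split; last by move=> x; right.
split=> // K idK XK K1 x Kx; apply: contrapT => nXx.
have hK a : hull K a <-> K a.
  by split=> [[//|Ja]|Ka]; [apply: XK; right|left].
apply: (maxX K).
  split=> [a Xa|e]; first by apply: XK; left.
  by apply: nXx; left; apply: e.
have -> : hull K = K by apply/funext => a; apply/propext.
by [].
Qed.

Section ModIdeal.
Variable m : A -> Prop.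
Hypothesis idm : is_ideal m.

Let m0 : m 0. Proof. by case: idm. Qed.
Let mD x y : m x -> m y -> m (x + y). Proof. by case: idm => _ h _; apply: h. Qed.
Let mM r x : m x -> m (r * x). Proof. by case: idm => _ _; apply. Qed.
Let mN x : m x -> m (- x). Proof. by rewrite -mulN1r; apply: mM. Qed.
Let mS I (r : seq I) (F : I -> A) : (forall i, m (F i)) -> m (\sum_(i <- r) F i).
Proof. by move=> mF; elim/big_ind: _. Qed.

Definition mx_in p q (X : 'M[A]_(p, q)) : Prop := forall i j, m (X i j).

Lemma mx_inD p q (X Y : 'M[A]_(p, q)) : mx_in X -> mx_in Y -> mx_in (X + Y).
Proof. by move=> hX hY i j; rewrite mxE; apply: mD. Qed.

Lemma mx_inN p q (X : 'M[A]_(p, q)) : mx_in X -> mx_in (- X).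
Proof. by move=> hX i j; rewrite mxE; apply: mN. Qed.

Lemma mx_inMl p q r (X : 'M[A]_(p, q)) (Y : 'M[A]_(q, r)) : mx_in Y -> mx_in (X *m Y).
Proof. by move=> hY i j; rewrite mxE; apply: mS => k; apply: mM. Qed.

Lemma mx_in_row p q r (X : 'M[A]_(p, q)) (Y : 'M[A]_(p, r)) :
  mx_in X -> mx_in Y -> mx_in (row_mx X Y).
Proof. by move=> hX hY i j; rewrite mxE; case: (fintype.split j) => k. Qed.

Lemma det_congr1 n (U : 'M[A]_n) : mx_in (U - 1%:M) -> m (\det U - 1).
Proof.
move=> hU; rewrite -(det1 A n) /determinant.
pose K x y := m (x - y).
have KD x1 x2 y1 y2 : K x1 x2 -> K y1 y2 -> K (x1 + y1) (x2 + y2).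
  by rewrite /K opprD addrACA; apply: mD.
have KM x1 x2 y1 y2 : K x1 x2 -> K y1 y2 -> K (x1 * y1) (x2 * y2).
  move=> h1 h2; have -> : K (x1 * y1) (x2 * y2) =
      m (y1 * (x1 - x2) + x2 * (y1 - y2)).
    by rewrite /K !mulrBr [y1 * x1]mulrC [y1 * x2]mulrC addrA subrK.
  by apply: mD; apply: mM.
have UK i j : K (U i j) (1%:M i j) by have := hU i j; rewrite !mxE.
have K1 x : K x x by rewrite /K subrr.
rewrite -/(K _ _); apply: (big_ind2 K) => [||s _]; [exact: K1|exact: KD|apply: (KM); first exact: K1].
apply: (big_ind2 K) => [||i _]; [exact: K1|exact: KM|].
exact: UK.
Qed.

(* Every matrix is von Neumann regular over the field [A / m]; a generalized
   inverse is built one column at a time. *)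
Lemma regular_mod : (forall d, ~ m d -> exists c, m (1 - c * d)) ->
  forall p q (B : 'M[A]_(p, q)), exists H : 'M_(q, p), mx_in (B *m H *m B - B).
Proof.
move=> inv p; elim=> [|q IH] B.
  by exists 0 => i [].
suff key (b : 'cV[A]_p) (B' : 'M[A]_(p, q)) :
    exists H : 'M_(1 + q, p), mx_in (row_mx b B' *m H *m row_mx b B' - row_mx b B').
  have := key (lsubmx (B : 'M_(p, 1 + q))) (rsubmx (B : 'M_(p, 1 + q))).
  by rewrite hsubmxK.
have [H' HE] := IH B'.
(* The part of the column [b] not accounted for by [B']. If it vanishes modulo [m], then [H'] with a
   zero row on top suffices. *)
pose d := b - B' *m H' *m b.
have [hd|nd] := pselect (mx_in d).
  exists (col_mx 0 H'); rewrite mul_row_col mulmx0 add0r mul_mx_row opp_row_mx add_row_mx.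
  by apply: mx_in_row => //; rewrite -opprB; apply: mx_inN.
have [i [j ndi]] : exists i j, ~ m (d i j).
  apply: contrapT => h; apply: nd => i j; apply: contrapT => nij.
  by apply: h; exists i, j.
have [c hc] := inv _ ndi.
(* Modulo [m] this row sends [b] to 1, because [c] inverts [d i j], and it annihilates [B']. *)
pose e := c *: row i (1%:M - B' *m H').
have eb : mx_in (e *m b - 1%:M).
  have -> : e *m b - 1%:M = - (1 - c * d i j)%:M.
    have -> : e *m b = (c * d i j)%:M.
      rewrite -scalemxAl -row_mul mulmxBl mul1mx -/d; apply/matrixP => k l.
      by rewrite !ord1 !mxE eqxx mulr1n.
    by rewrite -!raddfN -raddfD /= opprB addrC.
  by apply: mx_inN; move: (1 - _) hc => t ht k l; rewrite mxE !ord1 eqxx mulr1n.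
have eB : mx_in (e *m B').
  rewrite -scalemxAl -row_mul mulmxBl mul1mx => k l; rewrite !mxE; apply: mM.
  by have := mN (HE i l); rewrite !mxE opprB.
exists (col_mx e (H' - H' *m b *m e)).
rewrite mul_row_col mulmxBr !mulmxA mul_mx_row opp_row_mx add_row_mx.
apply: mx_in_row.
  have -> : (b *m e + (B' *m H' - B' *m H' *m b *m e)) *m b - b = d *m (e *m b - 1%:M).
    rewrite mulmxBr mulmx1 mulmxDl !mulmxBl -!(mulmxA _ e b).
    by rewrite opprB [RHS]addrACA !addrA.
  exact: mx_inMl.
have -> : (b *m e + (B' *m H' - B' *m H' *m b *m e)) *m B' - B' =
    d *m (e *m B') + (B' *m H' *m B' - B').
  by rewrite mulmxDl !mulmxBl -!(mulmxA _ e B') [RHS]addrACA !addrA.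
by apply: mx_inD => //; apply: mx_inMl.
Qed.

End ModIdeal.

Lemma maximal_inv (m : A -> Prop) : maximal_ideal m ->
  forall d, ~ m d -> exists c, m (1 - c * d).
Proof.
move=> [[m0 mD mM] m1 mmax] d nd; apply: contrapT => nc.
pose J x := exists c, m (x - c * d).
apply: nd; apply: (mmax J); first split.
- by exists 0; rewrite mul0r subr0.
- move=> x y [a ax] [b by_]; exists (a + b).
  by rewrite mulrDl opprD addrACA; apply: mD.
- by move=> r x [a ax]; exists (r * a); rewrite -mulrA -mulrBr; apply: mM.
- by move=> x mx; exists 0; rewrite mul0r subr0.
- by move=> [c cP]; apply: nc; exists c.
- by exists 1; rewrite mul1r subrr.
Qed.

(** If [H] is a generalized inverse of [B] modulo [m], the rows of 1 - B H kill [B] modulo [m], so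
    by exactness 1 - B H is congruent to some G C. Then U = B H + G C is congruent to 1, while U B =
    B H B because C B = 0; [det_regular] gives s = det U. *)
Lemma regular_local p q r (C : 'M[A]_(p, q)) (B : 'M[A]_(q, r)) (m : A -> Prop)
    (hm : @submod A A^o m) : C *m B = 0 -> maximal_ideal m ->
  tensor_exact (quotm hm) C B ->
  exists s, ~ m s /\ exists H : 'M_(r, q), s *: B = B *m H *m B.
Proof.
move=> CB maxm ex; have [idm m1 _] := maxm.
have [H HE] := regular_mod idm (maximal_inv maxm) B.
pose V := 1%:M - B *m H.
have VB : mx_in m (V *m B).
  by have := mx_inN idm HE; rewrite opprB mulmxBl mul1mx.
have /choice[G GE] : forall i, exists w : 'rV_p, mx_in m (row i V - w *m C).
  move=> i; have [|w wE] := ex (fun k => quotmap hm (V i k)).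
    move=> j; rewrite -mx_act_linear; apply/quotmap_ker.
    have := VB i j; rewrite mxE; congr m; apply: eq_bigr => k _; exact: mulrC.
  exists (\row_k val (w k)) => a k; rewrite !ord1.
  have := wE k; have {}wE l : w l = quotmap hm (val (w l)) by rewrite [RHS]qclass_val.
  rewrite (_ : mx_act C w k = quotmap hm (mx_act C (fun l => val (w l) : A^o) k)); last first.
    by rewrite mx_act_linear; apply: eq_bigr => l _; rewrite -wE.
  move/qclassP; rewrite !mxE; congr m; congr (_ - _).
  by apply: eq_bigr => l _; rewrite mxE; apply: mulrC.
pose U := B *m H + (\matrix_i G i) *m C.
have BHB : B *m H *m B = U *m B by rewrite mulmxDl -[_ *m C *m B]mulmxA CB mulmx0 addr0.
have U1 : mx_in m (U - 1%:M).
  rewrite -opprB; apply: (mx_inN idm) => i j.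
  have := GE i 0 j; rewrite /U opprD addrA -/V -[X in row i X]/V.
  have -> : G i *m C = row i ((\matrix_i G i) *m C) by rewrite row_mul rowK.
  by rewrite !mxE.
have A1 : (1 : A) != 0 by apply/eqP => e; apply: m1; rewrite e; case: idm.
have [H' H'E] := det_regular A1 BHB.
exists (\det U); split; last by exists H'.
have [_ mD mM] := idm => mU; apply: m1; have := det_congr1 idm U1.
move=> /(mM (-1)) h; have := mD _ _ mU h.
by rewrite mulN1r opprB addrC subrK.
Qed.

Lemma regular_global p q r (C : 'M[A]_(p, q)) (B : 'M[A]_(q, r)) : C *m B = 0 ->
  (forall m (hm : @submod A A^o m), maximal_ideal m -> tensor_exact (quotm hm) C B) ->
  exists H : 'M_(r, q), B = B *m H *m B.
Proof.
move=> CB ex; pose J s := exists H : 'M_(r, q), s *: B = B *m H *m B.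
have idJ : is_ideal J.
  split=> [|x y [H HE] [H' H'E]|s x [H HE]].
  - by exists 0; rewrite scale0r mulmx0 mul0mx.
  - by exists (H + H'); rewrite scalerDl HE H'E mulmxDr mulmxDl.
  - by exists (s *: H); rewrite -scalerA HE -scalemxAr -scalemxAl.
apply: contrapT => nH; have [|m [maxm Jm]] := maximal_ideal_exists idJ.
  by move=> [H]; rewrite scale1r => HE; apply: nH; exists H.
have [idm _ _] := maxm; have hm := (ideal_submod m).1 idm.
have [s [ns Js]] := regular_local CB maxm (ex m hm maxm).
exact/ns/Jm.
Qed.

Lemma rV_projective n : @projective A 'rV[A]_n.
Proof.
move=> M N f g sf.
have /choice[y yE] : forall i, exists y, f y = g (delta_mx 0 i) by move=> i; apply: sf.
have hl : linear (fun v : 'rV[A]_n => \sum_i v 0 i *: y i).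
  move=> a u v; rewrite scaler_sumr -big_split; apply: eq_bigr => i _.
  by rewrite !mxE scalerDl scalerA.
exists (linear_map hl) => v /=; rewrite [X in g X]row_sum_delta !linear_sum.
by apply: eq_bigr => i _; rewrite !linearZ yE.
Qed.

(** The map v |-> v - v H B kills the row space of [B] and differs from the identity by elements of
    it, so it induces a section of [c]. *)
Lemma projective_regular_coker q r (B : 'M[A]_(q, r)) (H : 'M_(r, q))
    (C : lmodType A) (c : {linear 'rV[A]_r -> C}) :
  B = B *m H *m B -> surj c -> (forall v, c v = 0 <-> exists w, v = w *m B) ->
  projective C.
Proof.
move=> BHB sc cB.
have hl : linear (fun v : 'rV[A]_r => v - v *m H *m B).
  by move=> a u v; rewrite !mulmxDl opprD -!scalemxAl addrACA -scalerBr.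
have [|g gE] := @factor_surj _ _ _ _ c (linear_map hl) sc.
  by move=> v /cB[w ->] /=; rewrite -!(mulmxA w) -BHB subrr.
apply: (projective_retract (s := g) (p := c) (@rV_projective r)) => x.
have [v <-] := sc x; rewrite gE /= linearB.
suff -> : c (v *m H *m B) = 0 by rewrite subr0.
by apply/cB; exists (v *m H).
Qed.

End Maximal.

(** * The implications between the five conditions *)

Section Equivalence.
Variable A : comPzRingType.
Implicit Types M N P Q K : lmodType A.

(** Descent along the resolution: the cokernel of [D n] is projective by [regular_global], and the
    cokernel of [D j.+1] is a syzygy of that of [D j]. *)
Lemma pdim_le_coker (r : nat -> nat) (D : forall i, 'M[A]_(r i.+1, r i)) n :
  (forall i, mx_exact (D i.+1) (D i)) ->
  (forall m (hm : @submod A A^o m), maximal_ideal m -> pdim_le n (quotm hm)) ->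
  forall k j, (j + k)%N = n -> forall Q (q : {linear 'rV[A]_(r j) -> Q}),
    surj q -> (forall v, q v = 0 <-> exists w, v = w *m D j) -> pdim_le k Q.
Proof.
move=> exD maxn; elim=> [|k IH] j jk Q q sq qD.
  rewrite addn0 in jk.
  have [|H HE] := regular_global (mx_exact_mul0 (exD j)).
    move=> m hm maxm; apply: (tensor_exact_pdim exD (maxn m hm maxm)).
    by rewrite jk.
  exact: (projective_regular_coker HE sq qD).
have fl : linear (fun v : 'rV[A]_(r j.+1) => v *m D j).
  by move=> a u v; rewrite mulmxDl scalemxAl.
pose f := linear_map fl.
have fE v : f v = v *m D j by [].
have hK := submod_image f; pose K : lmodType A := subm hK.
exists K, 'rV[A]_(r j), (submval hK), q; split.
- exact: rV_projective.
- split=> [|//|v]; first exact: submval_inj.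
  rewrite qD; split=> [[w ->]|[y <-]].
    by exists (insubm hK (w *m D j)); apply: insubmK; exists w.
  by have [w wE] := submvalP y; exists w; rewrite -fE wE.
have [|g gE] := @factor_inj _ _ _ _ (submval hK) f (@submval_inj _ _ _ hK).
  by move=> y; exists (insubm hK (f y)); apply: insubmK; exists y.
apply: (IH j.+1 _ K g) => [|x|v]; first by rewrite addSnnS.
  have [w wE] := submvalP x; exists w.
  by apply: (@submval_inj _ _ _ hK); rewrite gE wE.
rewrite -(exD j v) -fE -gE; split=> [->|h]; first exact: linear0.
by apply: (@submval_inj _ _ _ hK); rewrite h linear0.
Qed.

Lemma pdim_le_fg_quot n : coherent A ->
  (forall m (hm : @submod A A^o m), maximal_ideal m -> pdim_le n (quotm hm)) ->
  forall I Q (q : {linear A^o -> Q}), fg_ideal I -> surj q ->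
    (forall x : A, q x = 0 <-> I x) -> pdim_le n Q.
Proof.
move=> coh maxn I Q q [p [g gI]] sq qI.
pose state := {pq : nat * nat & 'M[A]_(pq.1, pq.2)}.
have next (s : state) : {m : nat & {Z : 'M[A]_(m, (tag s).1) | mx_exact Z (tagged s)}}.
  by have [m /cid Z] := cid (coherent_ker (tagged s) coh); exists m.
(* Iterating on matrices packed with their sizes builds the resolution; the column count of each new
   matrix is by construction the row count of the previous one, so [D] needs no casts. *)
pose step (s : state) : state :=
  existT (fun pq : nat * nat => 'M[A]_(pq.1, pq.2))
    (tag (next s), (tag s).1) (sval (tagged (next s))).
pose s0 : state :=
  existT (fun pq : nat * nat => 'M[A]_(pq.1, pq.2)) (p, 1%N) (\col_i g i).
pose r i := (tag (iter i step s0)).2.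
pose D i : 'M[A]_(r i.+1, r i) := tagged (iter i step s0).
have exD i : mx_exact (D i.+1) (D i) by apply: (svalP (tagged (next _))).
have ql : linear (fun v : 'rV[A]_1 => q (v 0 0)).
  by move=> a u v; rewrite !mxE; apply: linearP.
apply: (@pdim_le_coker r D n exD maxn n 0%N (add0n n) Q (linear_map ql)) => [u|v].
  by have [x <-] := sq u; exists (x%:M); rewrite /= mxE eqxx mulr1n.
rewrite /= qI gI; split=> [[c cE]|[w ->]].
  exists (\row_i c i); apply/matrixP => i j; rewrite !ord1 cE mxE.
  by apply: eq_bigr => k _; rewrite !mxE.
by exists (w 0); rewrite mxE; apply: eq_bigr => k _; rewrite !mxE.
Qed.

Lemma regular_module_projective : @projective A A^o.
Proof.
move=> M N f g sf; have [y yE] := sf (g 1).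
have hl : linear (fun a : A^o => a *: y) by move=> a u v; rewrite scalerDl -scalerA.
exists (linear_map hl) => x /=; rewrite linearZ yE -linearZ; congr (g _).
exact: mulr1.
Qed.

Lemma gldim_finite_fg k : aleph_noetherian k A ->
  fin_gldim_on (fun a : A -> Prop => is_ideal a /\ fg_ideal a) -> gldim_finite A.
Proof.
move=> aleph [n fgn].
have fgspan (s : seq A^o) : pdim_sub_le n (span (fun x => x \in s)).
  have hs := span_submod (fun x : A^o => x \in s).
  have ker := quotmap_ker hs; have sq := @quotmap_surj _ _ _ hs.
  have nQ : pdim_le n (quotm hs).
    apply/pd_le_pdim_le/(fgn (span (fun x => x \in s))); [|exact: sq|exact: ker].
    split; first exact/ideal_submod.
    exists (size s), (fun i => s`_i) => x; split=> [|[c ->]].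
      apply: (@span_min A A^o (fun x => x \in s)
        (fun x => exists c : 'I_(size s) -> A, x = \sum_i c i * s`_i)).
        split=> [|a u v [c ->] [d ->]].
          by exists (fun=> 0); rewrite big1 // => i _; rewrite mul0r.
        exists (fun i => a * c i + d i); rewrite scaler_sumr -big_split.
        by apply: eq_bigr => i _; rewrite mulrDl -mulrA.
      move=> y ys; have yi : (index y s < size s)%N by rewrite index_mem.
      exists (fun i => (i == Ordinal yi)%:R).
      rewrite (bigD1 (Ordinal yi)) //= eqxx mul1r nth_index // big1 ?addr0 // => i ni.
      by rewrite (negPf ni) mul0r.
    apply: (submod_sum hs) => i; apply: (submodZ hs); apply: mem_span; exact: mem_nth.
  apply/(pdim_sub_le_subm _ hs).
  have S : ses (submval hs) (quotmap hs).
    split=> [|//|x]; first exact: submval_inj.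
    rewrite ker; split=> [sx|[y <-]]; last exact: (submvalP y).
    by exists (insubm hs x); apply: insubmK.
  (* Weakening the bound to [n.+1] before taking the syzygy covers [n = 0] as well. *)
  exact: (pdim_le_syzygy S regular_module_projective (pdim_leS nQ)).
(* Ideals have dimension at most [n + k] by [pdim_family_span], and the cyclic quotients one
   more. *)
exists (n + k).+1 => M; apply: pdim_le_pd_le; move: M.
apply: pdim_le_cyclic => I Q q /[dup] idI /ideal_submod hI sq qI.
have [G [leG IG]] := aleph I idI.
have nI : pdim_sub_le (n + k) (I : A^o -> Prop).
  have h := pdim_family_span (g := sval : {x | G x} -> A^o) (l := [::]) fgspan leG.
  apply: (@pdim_sub_le_ext A _ A^o _ I _ h) => x.
  split; last first.
    move=> /IG[p [g [c [gG ->]]]]; apply: (submod_sum (span_submod _)) => i.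
    apply: (submodZ (span_submod _)); apply: mem_span; left.
    by exists (exist _ (g i) (gG i)).
  apply: (span_min hI) => _ [[t ->]|//]; apply/IG.
  exists 1%N, (fun=> sval t), (fun=> 1); split=> [_|]; first exact: svalP.
  by rewrite big_ord1 mul1r.
exists (subm hI), A^o, (submval hI), q; split.
- exact: regular_module_projective.
- split=> [|//|x]; first exact: submval_inj.
  rewrite qI; split=> [Ix|[y <-]]; last exact: (submvalP y).
  by exists (insubm hI x); apply: insubmK.
- exact/pdim_sub_le_subm.
Qed.

Lemma maximal_prime (m : A -> Prop) : maximal_ideal m -> prime_ideal m.
Proof.
move=> maxm; have [[m0 mD mM] m1 _] := maxm; split=> // x y mxy.
have [|nx] := pselect (m x); [by left|right].
have [c mc] := maximal_inv maxm nx.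
have -> : y = y * (1 - c * x) + c * (x * y).
  by rewrite mulrBr mulr1 mulrA [y * _]mulrC subrK.
by apply: mD; apply: mM.
Qed.

Lemma prime_radical (p : A -> Prop) : prime_ideal p -> radical_ideal p.
Proof.
(* At exponent 0 the assumption says that 1 lies in [p], which properness excludes. *)
move=> [idp p1 pM]; split=> // x; elim=> [/p1//|k IH].
by rewrite exprS => /pM[|/IH].
Qed.

End Equivalence.

(* k = n + 1 encodes the integer n >= -1 of the paper *)
Theorem theorem3p4 (A : comPzRingType) (k : nat) :
  coherent A -> aleph_noetherian k A ->
  [<-> gldim_finite A;
       fin_gldim_on (@radical_ideal A);
       fin_gldim_on (@prime_ideal A);
       fin_gldim_on (@maximal_ideal A);
       fin_gldim_on (fun a => @is_ideal A a /\ @fg_ideal A a)].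
Proof.
move=> coh aleph; tfae.
- by move=> [n h]; exists n => a _ Q q _ _; apply: h.
- by move=> [n h]; exists n => a /prime_radical/h.
- by move=> [n h]; exists n => a /maximal_prime/h.
(* The bound is a successor because [pd_le] is recovered from [pdim_le] only there. *)
- move=> [n h]; exists n.+1 => a [_ fga] Q q sq qa.
  apply/pdim_le_pd_le/pdim_leS; apply: (pdim_le_fg_quot coh _ fga sq qa).
  move=> m hm maxm; apply/pd_le_pdim_le/(h m maxm _ (quotmap hm)).
    exact: quotmap_surj.
  exact: (quotmap_ker hm).
- exact: gldim_finite_fg aleph.
Qed.
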